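(* For any $n$-node graph $G=(V,E)$ with arboricity $\alpha$ and maximum degree $\Delta$ such that $\alpha=\Delta^{1-\Theta(1)}$, and nonnegative node weights, there is a deterministic CONGEST algorithm that computes a $\Delta^{1-\Theta(1)}$-approximation for MWIS in $O(\log\alpha\log n)$ rounds.
   Context: The condition $\alpha=\Delta^{1-\Theta(1)}$ means $\alpha\leq\Delta^{1-c}$ for some constant $c>0$; the conclusion is an approximation ratio of at most $\Delta^{1-c'}$ for some constant $c'>0$. The arboricity $\alpha$ is the smallest integer such that $E$ can be partitioned into $\alpha$ forests. MWIS: given weights $w:V\to\mathbb{R}_{\geq0}$, $OPT(G)$ is the maximum of $w(I)=\sum_{v\in I}w(v)$ over independent sets $I$; an independent set $X$ is a $q$-approximation if $q\cdot w(X)\geq OPT(G)$. CONGEST model: synchronous rounds on the network $G$, unique $O(\log n)$-bit identifiers, $O(\log n)$-bit messages per edge per round; weights representable with $O(\log n)$ bits. Standing assumption: every node knows the value of $\alpha$. *)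

(* Defs.v *)
From HB Require Import structures.
From mathcomp Require Import all_boot all_order all_algebra.
From mathcomp Require Import reals exp.

Set Implicit Arguments.
Unset Strict Implicit.
Unset Printing Implicit Defensive.

Import Order.TTheory GRing.Theory Num.Theory.
Local Open Scope ring_scope.

Section Graphs.
Variables (V : finType) (e : rel V).

Definition simple_graph : Prop := symmetric e /\ irreflexive e.

Definition neighbors (v : V) : {set V} := [set u | e v u].

Definition max_degree : nat := \max_(v : V) #|neighbors v|.

(* In a symmetric relation every edge gives a [ucycle] of size 2, so only
   closed walks on at least 3 distinct vertices are graph cycles. *)
Definition is_forest (f : rel V) : Prop :=
  forall s : seq V, (2 < size s)%N -> ~ ucycle f s.

(* A partition of the edge set is encoded as a symmetric edge labelling; its
   values on non-edges are irrelevant. *)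
Definition forest_partition (a : nat) : Prop :=
  exists part : V -> V -> nat,
    [/\ forall x y, part x y = part y x,
        forall x y, e x y -> (part x y < a)%N
      & forall i, (i < a)%N -> is_forest [rel x y | e x y && (part x y == i)]].

Definition is_arboricity (a : nat) : Prop :=
  forest_partition a /\ forall b, forest_partition b -> (a <= b)%N.

Definition independent (I : {set V}) : bool :=
  [forall x in I, forall y in I, ~~ e x y].

Variable w : V -> rat.

Definition weight (I : {set V}) : rat := \sum_(v in I) w v.

(* The default value 0 is the weight of the independent set [set0]. *)
Definition OPT : rat :=
  \big[Num.max/0]_(I : {set V} | independent I) weight I.

Definition is_approximation (R : realType) (q : R) (X : {set V}) : Prop :=
  independent X /\ ratr OPT <= q * ratr (weight X).

End Graphs.

(* A deterministic CONGEST algorithm, run identically at every node.  Local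
   computation is unrestricted.  Nodes do not know the identifiers of their
   neighbors initially: they only see ports 0, ..., degree - 1. *)
Record congest_algorithm := CongestAlgorithm {
  state : Type;
  (* n, the arboricity, own degree, own identifier, own weight *)
  init : nat -> nat -> nat -> nat -> rat -> state;
  (* message sent through a given port; the empty string is silence *)
  send : state -> nat -> bitseq;
  (* state update from the messages received, listed by port *)
  receive : state -> seq bitseq -> state;
  (* [None] while running; [Some b] once the node has halted, where [b] tells
     whether the node belongs to the computed set *)
  output : state -> option bool
}.

(* Halted nodes are silent. *)
Definition outgoing (A : congest_algorithm) (s : state A) (i : nat) : bitseq :=
  if output s is Some _ then [::] else send s i.

Section Network.
Variables (V : finType) (e : rel V) (w : V -> rat).

(* [nth _ (ports v) i] is the neighbor of [v] behind port [i] of [v]. *)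
Definition port_numbering (ports : V -> seq V) : Prop :=
  forall v, perm_eq (ports v) (enum (neighbors e v)).

Definition log_bit_ids (k : nat) (id : V -> nat) : Prop :=
  injective id /\ forall v, (id v < #|V| ^ k)%N.

Definition log_bit_weights (k : nat) : Prop :=
  forall v, (`|numq (w v)| <= #|V| ^ k)%N /\ (`|denq (w v)| <= #|V| ^ k)%N.

Variables (A : congest_algorithm) (a : nat).
Variables (id : V -> nat) (ports : V -> seq V).

(* [exec t v] is the state of [v] after [t] synchronous rounds. *)
Fixpoint exec (t : nat) : V -> state A :=
  if t is t'.+1 then
    fun v =>
      let s := exec t' in
      if output (s v) is Some _ then s v
      else receive (s v)
             [seq outgoing (s u) (index v (ports u)) | u <- ports v]
  else fun v => init A #|V| a (size (ports v)) (id v) (w v).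

Definition message_bound (R : realType) (b : R) : Prop :=
  forall t v i, (i < size (ports v))%N ->
    (size (outgoing (exec t v) i))%:R <= b.

Definition computes_in (T : nat) (X : {set V}) : Prop :=
  forall v, output (exec T v) = Some (v \in X).

End Network.

(* Main.v *)
(* Peeling nodes of degree at most 4a for O(log n) rounds yields an orientation with
   out-degree at most 4a. Selecting each node with
   probability p and discarding a selected node with a selected out-neighbor gives
   expected weight at least w(V) p (1 - 4ap). This is derandomized by starting from
   p = 1/(8a) and, in log_g (8a) steps with g slightly below 2, keeping about half of
   the active nodes and multiplying p by g only: taking g < 2 pays for the nodes that
   decide simultaneously, namely the few monochromatic edges of a defective coloring
   with O(1) colors, which is computed from the identifiers by polynomial hashing in
   O(log n) rounds. The total loss is a factor O(a^(1+eps)), which is at most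
   Delta^(1-c') once Delta exceeds a constant D.

   For Delta <= D the ratio must be strictly smaller than Delta (equal to 1 when
   Delta = 1). Here the solution is improved by a constant number of sweeps of local
   moves centred at low-degree nodes: inserting a node, or all neighbors of a node
   when they are independent, if this multiplies the weight involved by more than
   theta > 1. A sweep that gains little certifies that the optimum is at most
   Delta - 1/(2K) times the current weight, where K is the number of colors used to
   separate simultaneous moves. Isolated edges are finally solved exactly. As moves
   never lose weight and are decided locally, nodes do not need to know Delta. *)

Require Import Defs.
From HB Require Import structures.
From mathcomp Require Import all_boot all_order all_algebra.
From mathcomp Require Import finfield.
From mathcomp Require Import zify ring lra.
From mathcomp Require Import boolp.
From mathcomp Require Import reals exp.

Set Implicit Arguments.
Unset Strict Implicit.
Unset Printing Implicit Defensive.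

Import Order.TTheory GRing.Theory Num.Theory.
Local Open Scope ring_scope.

(** * Density of graphs of small arboricity *)

(** No probabilities are needed: the estimate for the random selection extends to a quadratic form
    in a vector with entries 0, 1/2, 1. Putting 1/2 on all active nodes doubles the parameter at
    half the value, and nodes then move to 0 or 1 along the gradient. The second-order error comes
    only from pairs that move together, which is why edges inside a color class matter. Recoloring
    shortens the colors by a constant number of bits per round, with errors forming a geometric
    series; paying $O(\log n)$ rounds for it in each of $O(\log a)$ halvings gives the round bound.
    For bounded degree the obstacle is that single-node moves alone stop at ratio Delta, tight at
    solution nodes whose Delta neighbors all lie in the optimum; neighborhood moves are made for
    exactly these nodes. Constantly many sweeps suffice because phase one already secures a constant
    fraction of the total weight when Delta is bounded. The exponent $c'$ is fixed before the
    identifier exponent $k$, which only enters the number of rounds and the message size. *)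

Section Arboricity.
Variable V : finType.

(** Otherwise every node of [U] has two neighbors in [U], so a path can always be prolonged without
    turning back. Returning to an earlier vertex would close a cycle of length at least 3, so paths
    of every length exist, more than [V] has room for. *)
Lemma forest_low_degree (f : rel V) (U : {set V}) :
    symmetric f -> irreflexive f -> is_forest f -> U != set0 ->
  exists2 v, v \in U & (\sum_(u in U) f v u <= 1)%N.
Proof.
move=> fS fI fF /set0Pn[x0 x0U]; apply/exists_inP; apply: contraT.
rewrite negb_exists_in => /forall_inP high.
have ext v y : v \in U -> exists z, [/\ z \in U, f v z & z != y].
  move=> vU; have := high v vU; rewrite -ltnNge => h2.
  have [z /andP[zU /andP[vz zy]]|no] :=
    pickP (fun z => (z \in U) && (f v z && (z != y))); first by exists z.
  move: h2; suff -> : (\sum_(u in U) f v u = (y \in U) * f v y)%N.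
    by case: (y \in U) (f v y) => [] [].
  case yU: (y \in U); last first.
    rewrite big1 // => u uU; apply/eqP; rewrite eqb0; apply: contraT => /negPn vu.
    move: (no u); rewrite uU vu /= => /negbFE/eqP uy.
    by rewrite -uy uU in yU.
  rewrite (bigD1 y) //= big1 ?addn0 ?mul1n // => u /andP[uU uy].
  by apply/eqP; rewrite eqb0; have := no u; rewrite uU uy andbT /= => ->.
have long n : exists x p, [/\ uniq (x :: p), path f x p, all [in U] (x :: p)
                            & size p = n].
  elim: n => [|n [x [p [uxp fxp /andP[xU pU] sp]]]].
    by exists x0, [::]; split; rewrite //= x0U.
  (* The path grows at its head [x], avoiding the vertex visited just before. For empty [p] the
     default is [x] itself, which irreflexivity excludes anyway. *)
  have [z [zU xz zp]] := ext x (head x p) xU.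
  have zx : z != x by apply: contraTneq xz => ->; rewrite fI.
  have zNp : z \notin p.
    apply/negP => /splitPr dp; case: dp fxp uxp zp pU sp => p1 p2.
    case: p1 => [|y p1] fxp uxp zp pU sp; first by rewrite /= eqxx in zp.
    apply: (fF (x :: (y :: p1) ++ [:: z])).
      by rewrite /= size_cat /= addn1.
    apply/andP; split; last first.
      by move: uxp; rewrite -[z :: p2]cat1s catA -cat_cons cat_uniq => /andP[].
    move: fxp; rewrite /cycle rcons_cat !cat_path.
    by case/andP => -> /=; case/andP => -> _ /=; rewrite fS xz.
  exists z, (x :: p); split; rewrite /= ?sp //.
  - by rewrite inE negb_or zx zNp.
  - by rewrite fS xz.
  - by rewrite zU xU.
have [x [p [uxp _ _ sp]]] := long #|V|.
by have := max_card [in x :: p]; rewrite (card_uniqP uxp) /= sp ltnn.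
Qed.

Lemma forest_degree_sum (f : rel V) (U : {set V}) :
    symmetric f -> irreflexive f -> is_forest f ->
  (\sum_(v in U) \sum_(u in U) f v u <= 2 * #|U|)%N.
Proof.
move=> fS fI fF; elim: {U}#|U| {-2}U (erefl #|U|) => [U /cards0_eq ->|n IH U cU].
  by rewrite big_set0.
have Un0 : U != set0 by rewrite -card_gt0 cU.
have [v vU dv] := forest_low_degree fS fI fF Un0.
have cD : #|U :\ v| = n by apply/eqP; rewrite -eqSS -cU (cardsD1 v U) vU.
have -> : (\sum_(x in U) \sum_(u in U) f x u =
  (\sum_(u in U) f v u) + ((\sum_(x in U) f x v) +
    \sum_(x in U :\ v) \sum_(u in U :\ v) f x u))%N.
  rewrite (big_setD1 v) //=; congr addn.
  rewrite (big_setD1 v vU) /= fI add0n -big_split /=.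
  by apply: eq_bigr => x _; rewrite (big_setD1 v).
have -> : (\sum_(x in U) f x v = \sum_(x in U) f v x)%N.
  by apply: eq_bigr => x _; rewrite fS.
by have := IH _ cD; rewrite cD cU; lia.
Qed.

(** Each forest contributes at most $2|U|$. Peeling applies this to the set of nodes that are still
    active. *)
Lemma arboricity_degree_sum (e : rel V) (a : nat) (U : {set V}) :
    simple_graph e -> forest_partition e a ->
  (\sum_(v in U) #|[set u in U | e v u]| <= 2 * a * #|U|)%N.
Proof.
move=> [eS eI] [part [pS pa pF]].
pose f (i : nat) := [rel x y | e x y && (part x y == i)].
have split_edge v u : ((e v u : nat) <= \sum_(i < a) f i v u)%N.
  case evu: (e v u) => //.
  rewrite (bigD1 (Ordinal (pa _ _ evu))) //= evu eqxx /=; lia.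
have -> : (2 * a * #|U| = \sum_(i < a) 2 * #|U|)%N.
  by rewrite sum_nat_const card_ord; lia.
apply: (@leq_trans (\sum_(i < a) \sum_(v in U) \sum_(u in U) f i v u)); last first.
  apply: leq_sum => i _; apply: forest_degree_sum.
  - by move=> x y; rewrite /= eS pS.
  - by move=> x; rewrite /= eI.
  - exact: pF.
rewrite exchange_big; apply: leq_sum => v _.
rewrite exchange_big -sum1_card (eq_bigl (fun u => (u \in U) && e v u)); last first.
  by move=> u; rewrite inE.
rewrite big_mkcondr; apply: leq_sum => u _; exact: split_edge.
Qed.

End Arboricity.

(** * Polynomial hashing *)

Definition hash_family (h : nat -> nat -> nat -> nat) : Prop :=
  forall m, (0 < m)%N ->
    (forall al c, (h m al c < 2 ^ m)%N) /\
    (forall c c', (c < 2 ^ (3 * m))%N -> (c' < 2 ^ (3 * m))%N -> c != c' ->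
       (count (fun al => h m al c == h m al c') (iota 0 (2 ^ m)) <= 2)%N).

(* The three base-2^m digits of c are the coefficients of a polynomial over
   GF(2^m); [h m al c] is its value at the al-th field element. *)
Lemma hash_family_exists : exists h, hash_family h.
Proof.
suff /boolp.choice[h hh] : forall m, exists hm : nat -> nat -> nat, (0 < m)%N ->
    (forall al c, (hm al c < 2 ^ m)%N) /\
    (forall c c', (c < 2 ^ (3 * m))%N -> (c' < 2 ^ (3 * m))%N -> c != c' ->
       (count (fun al => hm al c == hm al c') (iota 0 (2 ^ m)) <= 2)%N).
  by exists h.
case=> [|m]; first by exists (fun _ _ => 0%N).
set q := (2 ^ m.+1)%N.
have [F _ cF] := pPrimePowerField (p := 2) isT (ltn0Sn m).
have q0 : (0 < q)%N by rewrite expn_gt0.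
pose el i : F := nth 0 (enum F) i.
have sF : size (enum F) = q by rewrite -cardT.
have el_inj i j : (i < q)%N -> (j < q)%N -> el i = el j -> i = j.
  by move=> iq jq /eqP; rewrite nth_uniq ?sF ?enum_uniq // => /eqP.
pose P c : {poly F} := Poly [:: el (c %% q)%N; el (c %/ q %% q)%N; el (c %/ q %/ q)%N].
exists (fun al c => index ((P c).[el al]) (enum F)) => _; split => [al c|c c' hc hc' cc'].
  by rewrite -/q -sF index_mem mem_enum.
rewrite mulSn mulSn mul1n !expnD -/q in hc hc'.
have dig x : (x < q * (q * q))%N -> (x %/ q %/ q < q)%N.
  by move=> hx; rewrite !ltn_divLR // -mulnA.
have D0 : P c - P c' != 0.
  rewrite subr_eq0; apply: contra_neq cc' => Pcc.
  have co i : (P c)`_i = (P c')`_i by rewrite Pcc.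
  have := co 0%N; rewrite !coef_Poly /= => /el_inj e0.
  have := co 1%N; rewrite !coef_Poly /= => /el_inj e1.
  have := co 2%N; rewrite !coef_Poly /= => /el_inj e2.
  rewrite (divn_eq c q) (divn_eq c' q) e0 ?ltn_mod //.
  by rewrite (divn_eq (c %/ q) q) (divn_eq (c' %/ q) q) e1 ?ltn_mod // e2 ?dig.
have sz : (size (P c - P c')%R <= 3)%N.
  apply: (leq_trans (size_polyD _ _)); rewrite size_polyN geq_max.
  by rewrite !(leq_trans (size_Poly _)).
pose al0 al := index (P c).[el al] (enum F) == index (P c').[el al] (enum F).
rewrite -size_filter -(size_map el) -ltnS; apply: leq_trans sz.
apply: max_poly_roots => //.
  apply/allP => x /mapP[al]; rewrite mem_filter => /andP[/eqP eqi _] ->.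
  rewrite /root hornerD hornerN subr_eq0; apply/eqP.
  have := congr1 (nth 0 (enum F)) eqi.
  by rewrite !nth_index ?mem_enum.
rewrite map_inj_in_uniq ?filter_uniq ?iota_uniq // => i j.
rewrite !mem_filter !mem_iota !add0n => /andP[_ /andP[_ iq]] /andP[_ /andP[_ jq]].
exact: el_inj.
Qed.

(** The default 0 keeps the result below [q] even if the search fails, so bounds on color sizes do
    not depend on the reason why it succeeds. *)
Definition first_below (P : pred nat) (q : nat) : nat :=
  let i := find P (iota 0 q) in if (i < q)%N then i else 0%N.

Lemma first_below_lt P q : (0 < q)%N -> (first_below P q < q)%N.
Proof. by rewrite /first_below; case: ifP. Qed.

Lemma first_belowP (P : pred nat) q :
  (exists2 i, (i < q)%N & P i) -> P (first_below P q).
Proof.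
move=> [i iq Pi]; have hP : has P (iota 0 q).
  by apply/hasP; exists i; rewrite ?mem_iota.
have := nth_find 0%N hP; have := hP; rewrite has_find size_iota => fq.
by rewrite nth_iota // add0n /first_below fq.
Qed.

(** * Halving the active set *)

Section Halving.
Variables (V : finType) (e : rel V) (w : V -> rat) (lay : V -> nat).
Hypotheses (eS : symmetric e) (w0 : forall v, 0 <= w v).

(* The orientation points to equal or higher layers, so an edge inside a layer is
   oriented both ways and counts both weights. *)
Definition edge_weight (v u : V) : rat :=
  (if (lay v <= lay u)%N then w v else 0) + (if (lay u <= lay v)%N then w u else 0).

Lemma edge_weightC v u : edge_weight v u = edge_weight u v.
Proof. by rewrite /edge_weight addrC. Qed.

Lemma edge_weight_ge0 v u : 0 <= edge_weight v u.
Proof. by rewrite addr_ge0 //; case: ifP. Qed.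

Definition out_degree (A : {set V}) v : nat :=
  #|[set u in A | e v u & (lay v <= lay u)%N]|.

(** Selecting nodes of [A] with probability $p$ and applying a union bound over out-neighbors yields
    expected weight at least $p$ times this quantity. *)
Definition potential (A : {set V}) (p : rat) : rat :=
  weight w A - p * \sum_(v in A) w v * (out_degree A v)%:R.

Definition mass (A : {set V}) : rat :=
  \sum_(v in A) \sum_(u in A | e v u) edge_weight v u.

Definition mono (A : {set V}) (c : V -> nat) : rat :=
  \sum_(v in A) \sum_(u in A | e v u && (c u == c v)) edge_weight v u.

Lemma mass_ge0 A : 0 <= mass A.
Proof. by do 2!apply: sumr_ge0 => ? _; exact: edge_weight_ge0. Qed.

Lemma mass_out_degree A :
  mass A = 2%:R * \sum_(v in A) w v * (out_degree A v)%:R.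
Proof.
have sw : \sum_(v in A) w v * (out_degree A v)%:R =
    \sum_(v in A) \sum_(u in A | e v u) (if (lay v <= lay u)%N then w v else 0).
  apply: eq_bigr => v _; rewrite -big_mkcondr /= sumr_const mulr_natr.
  by congr (_ *+ _); apply: eq_card => u; rewrite !inE andbA.
rewrite mulr_natl mulr2n {1}sw sw /mass.
under eq_bigr => v _ do rewrite big_split.
rewrite big_split /=; congr (_ + _).
rewrite (exchange_big_dep (mem A)) /=; last by move=> i j _ /andP[].
apply: eq_bigr => v vA; apply: eq_bigl => u.
by rewrite eS vA /= ?andbT.
Qed.

Section DefectiveColoring.
Variables (h : nat -> nat -> nat -> nat) (m : nat).
Hypotheses (hash_h : hash_family h) (m0 : (0 < m)%N).
Variables (A : {set V}) (c : V -> nat).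
Hypothesis c_lt : forall v, v \in A -> (c v < 2 ^ (3 * m))%N.

Definition conflict v al : rat :=
  \sum_(u in A | e v u && ((c u != c v) && (h m al (c u) == h m al (c v))))
     edge_weight v u.

Definition incident v : rat := \sum_(u in A | e v u) edge_weight v u.

(** Averaging over all points: a neighbor of another color collides at no more than two of the $2^m$
    points, so the conflicts add up to at most twice the incident weight. *)
Lemma low_conflict v : v \in A ->
  exists2 al, (al < 2 ^ m)%N & conflict v al * (2 ^ m)%:R <= 2%:R * incident v.
Proof.
move=> vA; have [al|high] := pselect (exists2 al, (al < 2 ^ m)%N &
  conflict v al * (2 ^ m)%:R <= 2%:R * incident v); first by [].
have q0 : (0 < 2 ^ m)%N by rewrite expn_gt0.
have sum_le : \sum_(0 <= al < 2 ^ m) conflict v al <= 2%:R * incident v.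
  rewrite /conflict /incident.
  under eq_bigr => al _.
    rewrite big_mkcond /=.
    over.
  rewrite exchange_big /= [in leRHS]big_mkcond mulr_sumr; apply: ler_sum => u _.
  case uA: (u \in A) => /=; last by rewrite big1 // mulr0.
  case evu: (e v u) => /=; last by rewrite big1 // mulr0.
  case cuv: (c u != c v) => /=; last first.
    by rewrite big1 // mulr_ge0 ?edge_weight_ge0.
  rewrite -big_mkcond /= big_const_seq iter_addr_0 -[leLHS]mulr_natl.
  rewrite ler_wpM2r ?edge_weight_ge0 // ler_nat.
  rewrite /index_iota subn0; apply: (hash_h m0).2 cuv; exact: c_lt.
have : \sum_(0 <= al < 2 ^ m) (conflict v al * (2 ^ m)%:R) >
       \sum_(0 <= al < 2 ^ m) (2%:R * incident v).
  apply: ltr_sum_nat => // al /= alq; rewrite ltNge; apply/negP => le.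
  by apply: high; exists al.
rewrite -[ltRHS]mulr_suml sumr_const_nat subn0 -[ltLHS]mulr_natr ltr_pM2r ?ltr0n // => lt.
by have := lt_le_trans lt sum_le; rewrite ltxx.
Qed.

(** The pair of point and value, written with $2m$ bits. As $2m\le 3(m-1)$ for $m\ge3$, it is again
    a valid key for the next smaller field. *)
Definition recolor v (al : nat) : nat := (al * 2 ^ m + h m al (c v))%N.

Lemma recolor_lt v al : (al < 2 ^ m)%N -> (recolor v al < 2 ^ (2 * m))%N.
Proof.
move=> alq; have hq := (hash_h m0).1 al (c v).
rewrite /recolor mul2n -addnn expnD.
apply: (@leq_trans (al * 2 ^ m + 2 ^ m)); first by rewrite ltn_add2l.
by rewrite -mulSnr leq_mul2r alq orbT.
Qed.

Lemma recolor_inj v u al be :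
  recolor v al = recolor u be -> al = be /\ h m al (c v) = h m be (c u).
Proof.
move=> E; have q0 : (0 < 2 ^ m)%N by rewrite expn_gt0.
have hv := (hash_h m0).1 al (c v); have hu := (hash_h m0).1 be (c u).
move: (congr1 (divn^~ (2 ^ m)%N) E) (congr1 (modn^~ (2 ^ m)%N) E).
by rewrite /recolor !divnMDl // !divn_small // !addn0 !modnMDl !modn_small.
Qed.

(** Although all nodes choose at once, equal new colors force equal points. A newly monochromatic
    edge is therefore a collision at the point of [v] itself, already counted in
    [conflict v (al v)]. *)
Lemma mono_recolor (al : V -> nat) :
    (forall v, v \in A -> conflict v (al v) * (2 ^ m)%:R <= 2%:R * incident v) ->
  mono A (fun v => recolor v (al v)) <= mono A c + 2%:R / (2 ^ m)%:R * mass A.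
Proof.
move=> low; rewrite /mono /mass mulr_sumr -big_split /=.
apply: ler_sum => v vA.
have q0 : 0 < (2 ^ m)%:R :> rat by rewrite ltr0n expn_gt0.
have : conflict v (al v) <= 2%:R / (2 ^ m)%:R * incident v.
  by rewrite mulrAC ler_pdivlMr ?low.
move=> le; apply: le_trans (lerD (lexx _) le).
rewrite /conflict [leLHS]big_mkcond [X in X + _]big_mkcond [X in _ + X]big_mkcond.
rewrite -big_split; apply: ler_sum => u _ /=.
case: (u \in A); case: (e v u); rewrite //= ?addr0 //.
have W0 := edge_weight_ge0 v u.
case: eqP => [/recolor_inj [e1 e2]|_].
  by case: eqP => ceq /=; [rewrite addr0|rewrite -e2 e1 eqxx add0r].
by rewrite addr_ge0 //; case: ifP.
Qed.

End DefectiveColoring.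

(** * Quadratic relaxation and rounding by color classes *)

Definition bilin (x y : V -> rat) : rat :=
  \sum_v \sum_(u | e v u) edge_weight v u * (x v * y u).

Lemma bilinC x y : bilin x y = bilin y x.
Proof.
rewrite /bilin (exchange_big_dep predT) //=; apply: eq_bigr => v _.
apply: eq_big => [u|u _]; first by rewrite eS.
by rewrite edge_weightC [x u * _]mulrC.
Qed.

Lemma bilinDl x x' y : bilin (fun v => x v + x' v) y = bilin x y + bilin x' y.
Proof.
rewrite /bilin -big_split; apply: eq_bigr => v _ /=; rewrite -big_split.
by apply: eq_bigr => u _ /=; rewrite -mulrDr -mulrDl.
Qed.

(** Extension of [potential] from sets to fractional vectors; the halved coefficient compensates for
    [bilin] counting each edge in both directions. [slope] is the gradient, and the second-order
    expansion [relaxedD] is exact. *)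
Definition relaxed (b : rat) (y : V -> rat) : rat :=
  \sum_v w v * y v - b / 2%:R * bilin y y.

Definition slope (b : rat) (y : V -> rat) v : rat :=
  w v - b * \sum_(u | e v u) edge_weight v u * y u.

Lemma relaxedD b y z : relaxed b (fun v => y v + z v) =
  relaxed b y + \sum_v z v * slope b y v - b / 2%:R * bilin z z.
Proof.
rewrite /relaxed bilinDl [bilin y _]bilinC [bilin z _]bilinC !bilinDl.
have -> : \sum_v w v * (y v + z v) = \sum_v w v * y v + \sum_v w v * z v.
  by rewrite -big_split; apply: eq_bigr => v _; rewrite mulrDr.
have -> : \sum_v z v * slope b y v = \sum_v w v * z v - b * bilin z y.
  rewrite /bilin mulr_sumr -sumrB; apply: eq_bigr => v _.
  rewrite /slope mulrBr [z v * w v]mulrC; congr (_ - _).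
  rewrite mulrCA; congr (b * _); rewrite mulr_sumr; apply: eq_bigr => u _.
  by rewrite mulrCA.
rewrite [bilin y z]bilinC; by field.
Qed.

Definition frac (act und : V -> bool) v : rat :=
  if act v then if und v then 1 / 2%:R else 1 else 0.

Definition class_mass (A : {set V}) (c : V -> nat) k : rat :=
  \sum_(v in A | c v == k) \sum_(u in A | e v u && (c u == k)) edge_weight v u.

Lemma sum_class_mass (A : {set V}) (c : V -> nat) K : (forall v, v \in A -> (c v < K)%N) ->
  \sum_(0 <= k < K) class_mass A c k = mono A c.
Proof.
move=> cK; rewrite /class_mass /mono; under eq_bigr => k _ do rewrite big_mkcondr /=.
rewrite exchange_big /=; apply: eq_bigr => v vA; rewrite big_mkord.
rewrite (bigD1 (Ordinal (cK v vA))) //= eqxx [X in _ + X]big1 ?addr0 //.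
by move=> k kv; case: eqP => // ck; case/eqP: kv; apply: val_inj.
Qed.

(** Each entry of the change [z] is 0 or 1/2 in the direction of the gradient, so the linear term
    cannot hurt. The quadratic term only sees pairs inside class [k], each with product at most 1/4;
    together with the coefficient $b/2$ this gives $b/8$. *)
Lemma round_class (b : rat) (A : {set V}) (c : V -> nat) (k : nat)
    (act und act' und' : V -> bool) :
    0 <= b ->
    (forall v, act v -> v \in A) ->
    (forall v, act' v = if [&& act v, und v & c v == k]
                        then 0 <= slope b (frac act und) v else act v) ->
    (forall v, und' v = und v && (c v != k)) ->
  relaxed b (frac act und) - b / 8%:R * class_mass A c k <=
  relaxed b (frac act' und').
Proof.
move=> b0 actA act'E und'E; set y := frac act und.
pose z v := frac act' und' v - y v.
have -> : relaxed b (frac act' und') = relaxed b (fun v => y v + z v).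
  by congr relaxed; apply/funext => v; rewrite /z addrC subrK.
rewrite relaxedD.
have zE v : z v = if [&& act v, und v & c v == k] then
    if 0 <= slope b y v then 1 / 2%:R else - (1 / 2%:R) else 0.
  rewrite /z /y /frac act'E und'E -/y.
  by case: (act v) (und v) (c v == k) => [] [] [] //=; try case: ifP => _; lra.
have lin : 0 <= \sum_v z v * slope b y v.
  apply: sumr_ge0 => v _; rewrite zE; case: ifP; rewrite ?mul0r // => _.
  by case: (leP 0 (slope b y v)) => h; lra.
have quad : bilin z z <= class_mass A c k / 4%:R.
  rewrite /bilin /class_mass mulr_suml [leRHS]big_mkcond.
  apply: ler_sum => v _; rewrite mulr_suml.
  have W0 u := edge_weight_ge0 v u.
  have zz v' : z v' = 0 \/ [/\ v' \in A, c v' = k & `|z v'| = 1 / 2%:R].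
    rewrite zE; case: ifP => [/and3P[av _ /eqP ck]|_]; last by left.
    right; split => //; first exact: actA.
    by case: ifP => _; rewrite ?normrN ger0_norm.
  case: (zz v) => [z0|[vA ck zv]].
    rewrite z0 big1; last by move=> u _; rewrite mul0r mulr0.
    by case: ifP => // _; apply: sumr_ge0 => u _; rewrite mulr_ge0.
  rewrite vA ck eqxx /= big_mkcond [leRHS]big_mkcond.
  apply: ler_sum => u _; case evu: (e v u) => /=; last by rewrite andbF.
  case: (zz u) => [->|[uA cu zu]].
    by rewrite !mulr0; case: ifP => _ //; rewrite mulr_ge0.
  rewrite uA cu eqxx /=; apply: ler_wpM2l => //.
  by rewrite (le_trans (ler_norm _)) // normrM zv zu.
move: lin (ler_wpM2l b0 quad).
move: (relaxed b y) (\sum_v _) (bilin z z) (class_mass A c k) => r s B C hs hB.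
have -> : b / 8%:R * C = b * (C / 4%:R) / 2%:R by field.
have -> : b / 2%:R * B = b * B / 2%:R by field.
move: (b * B) (b * (C / 4%:R)) hB => x y' hB; lra.
Qed.

(** The linear part is halved and the quadratic part quartered; for $b=2p$ this is exactly half of
    [potential A p]. *)
Lemma relaxed_half b (A : {set V}) (act und : V -> bool) :
    (forall v, act v = (v \in A)) -> (forall v, v \in A -> und v) ->
  relaxed b (frac act und) = weight w A / 2%:R - b / 8%:R * mass A.
Proof.
move=> aA uA; have fE v : frac act und v = if v \in A then 1 / 2%:R else 0.
  by rewrite /frac aA; case: ifP => // /uA ->.
rewrite /relaxed /weight /bilin /mass; congr (_ - _).
  rewrite mulr_suml [RHS]big_mkcond; apply: eq_bigr => v _.
  by rewrite fE; case: ifP; rewrite ?mulr0 // mul1r.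
rewrite [b / 8%:R](_ : _ = b / 2%:R / 4%:R); last by field.
rewrite -[RHS]mulrA; congr (_ * _); rewrite mulr_sumr [RHS]big_mkcond.
apply: eq_bigr => v _; rewrite fE; case: ifP => vA; last first.
  by rewrite big1 // => u _; rewrite mul0r mulr0.
rewrite mulr_sumr big_mkcond [RHS]big_mkcond; apply: eq_bigr => u _ /=.
rewrite fE; case: (u \in A); case: (e v u) => //=; rewrite ?mulr0 //; by field.
Qed.

Lemma relaxed_integral b (A : {set V}) (act und : V -> bool) :
    (forall v, act v = (v \in A)) -> (forall v, v \in A -> ~~ und v) ->
  relaxed b (frac act und) = potential A b.
Proof.
move=> aA uA; have fE v : frac act und v = if v \in A then 1 else 0.
  by rewrite /frac aA; case: ifP => // /uA/negbTE ->.
have -> : potential A b = weight w A - b / 2%:R * mass A.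
  rewrite /potential mass_out_degree; by field.
rewrite /relaxed /weight /bilin /mass; congr (_ - _).
  by rewrite [RHS]big_mkcond; apply: eq_bigr => v _; rewrite fE; case: ifP; rewrite ?mulr0 ?mulr1.
congr (_ * _); rewrite [RHS]big_mkcond.
apply: eq_bigr => v _; rewrite fE; case: ifP => vA; last first.
  by rewrite big1 // => u _; rewrite mul0r mulr0.
rewrite big_mkcond [RHS]big_mkcond; apply: eq_bigr => u _ /=.
by rewrite fE; case: (u \in A); case: (e v u); rewrite //= ?mulr0 ?mul1r ?mulr1.
Qed.

Lemma potential0 (A : {set V}) (p : rat) (d : nat) : (forall v, (out_degree A v <= d)%N) -> 0 <= p ->
    p * d%:R <= 1 / 2%:R ->
  weight w A / 2%:R <= potential A p.
Proof.
move=> od p0 pd; rewrite /potential.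
have : \sum_(v in A) w v * (out_degree A v)%:R <= weight w A * d%:R.
  rewrite mulr_suml; apply: ler_sum => v _.
  by rewrite ler_wpM2l // ler_nat od.
have W0 : 0 <= weight w A by apply: sumr_ge0.
move=> le; have := ler_wpM2l p0 le; have := ler_wpM2l W0 pd; lra.
Qed.

(** Once $p\ge1$, a node with an out-neighbor in [A] contributes at most 0, so only the sinks
    count. *)
Lemma potential_sinks (A : {set V}) (p : rat) (S : {set V}) : 1 <= p ->
    (forall v, (v \in S) = (v \in A) && (out_degree A v == 0%N)) ->
  potential A p <= weight w S.
Proof.
move=> p1 SE; rewrite /potential /weight mulr_sumr -sumrB [leRHS]big_mkcond.
rewrite [leLHS]big_mkcond; apply: ler_sum => v _; rewrite SE.
case: (v \in A) => //=; have wv := w0 v.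
case: eqP => [->|/eqP]; first by rewrite mulr0 mulr0 subr0.
rewrite -lt0n => od; have od1 : 1 <= (out_degree A v)%:R :> rat by rewrite ler1n.
rewrite subr_le0 mulrCA ler_peMr //.
by rewrite -[1]mulr1 ler_pM.
Qed.

End Halving.

(** * Local search *)

Section LocalSearch.
Variables (V : finType) (e : rel V) (w : V -> rat).
Hypotheses (eS : symmetric e) (eI : irreflexive e) (w0 : forall v, 0 <= w v).
Variable theta : rat.
Hypothesis theta1 : 1 < theta.

Let theta0 : 0 < theta. Proof. exact: lt_trans theta1. Qed.

Definition on (S : {set V}) v : rat := if v \in S then w v else 0.

Lemma on_ge0 S v : 0 <= on S v.
Proof. by rewrite /on; case: ifP. Qed.

Lemma sum_on S : \sum_v on S v = weight w S.
Proof. by rewrite /weight [RHS]big_mkcond. Qed.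

(* A move of type [b] centred at [v] inserts [v] itself ([b = false]) or the
   whole neighborhood of [v] ([b = true]). *)
Definition inserted (b : bool) v : {set V} :=
  if b then neighbors e v else [set v].

(* For [b = true] the centre is charged once, not once per inserted neighbor: this
   saving is what brings the ratio below the maximum degree. *)
Definition charge (b : bool) v x : nat :=
  if b then ((x == v) + \sum_(u | e v u) ((x == u) + (e u x && (x != v))))%N
  else ((x == v) + e v x)%N.

(** Taken at a weight function rather than a set, because claims made at different moments of a
    sweep are later compared with one common function, the initial solution plus all insertions. *)
Definition cost b (sg : V -> rat) v : rat := \sum_x sg x * (charge b v x)%:R.

Lemma le_cost b sg sg' v : (forall x, sg x <= sg' x) -> cost b sg v <= cost b sg' v.
Proof. by move=> le; apply: ler_sum => x _; rewrite ler_wpM2r. Qed.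

Lemma charge_gt0 b v x :
    (x \in inserted b v) || [exists u in inserted b v, e x u] ->
  (0 < charge b v x)%N.
Proof.
case: b; rewrite /= inE.
  case: eqP => //= xv /orP[vx|/exists_inP[u]].
    by rewrite (bigD1 x) //= eqxx.
  by rewrite inE => vu xu; rewrite (bigD1 u) //= [e u x]eS xu andbT addn1.
case: eqP => //= _ /exists_inP[u]; rewrite inE => /eqP ->.
by rewrite eS => ->.
Qed.

Lemma charge_inserted b v x : x \in inserted b v -> (0 < charge b v x)%N.
Proof. by move=> xA; apply: charge_gt0; rewrite xA. Qed.

Definition fired b (C S : {set V}) : {set V} :=
  [set v in C | theta * cost b (on S) v < weight w (inserted b v)].

Definition insertions b (C S : {set V}) : {set V} :=
  [set x | [exists v in fired b C S, x \in inserted b v]].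

Definition turn b (C S : {set V}) : {set V} :=
  [set x | (x \in insertions b C S) ||
           (x \in S) && ~~ [exists u in insertions b C S, e x u]].

(** Only the inserted sets of simultaneous moves have to be disjoint and mutually non-adjacent. The
    moves may remove common nodes. *)
Definition spread b (C : {set V}) : Prop :=
  forall v v' x x', v \in C -> v' \in C -> x \in inserted b v ->
    x' \in inserted b v' -> ~~ e x x' /\ (x = x' -> v = v').

Lemma turn_independent b C S : spread b C -> independent e S ->
  independent e (turn b C S).
Proof.
move=> sp iS; have insP x y : x \in insertions b C S -> y \in insertions b C S -> ~~ e x y.
  rewrite !inE => /exists_inP[v]; rewrite inE => /andP[vC _] xv.
  by move=> /exists_inP[v']; rewrite inE => /andP[v'C _] yv'; have [] := sp v v' x y.
apply/forall_inP => x; rewrite inE => hx; apply/forall_inP => y; rewrite inE => hy.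
case/orP: hx => [xi|/andP[xS xN]]; case/orP: hy => [yi|/andP[yS yN]].
- exact: insP.
- by apply: contra yN => xy; apply/exists_inP; exists x; rewrite // eS.
- by apply: contra xN => xy; apply/exists_inP; exists y.
- by have /forall_inP/(_ x xS)/forall_inP/(_ y yS) := iS.
Qed.

(** A node removed by several moves is charged to each of them, which only weakens the bound;
    disjointness of the inserted sets makes the gains add up. *)
Lemma turn_gain b C S : spread b C ->
  \sum_(v in fired b C S) (weight w (inserted b v) - cost b (on S) v) <=
  weight w (turn b C S) - weight w S.
Proof.
move=> sp; set F := fired b C S; set I := insertions b C S.
have IE x : (x \in I) = [exists v in F, x \in inserted b v] by rewrite inE.
have insw : \sum_(v in F) weight w (inserted b v) <= weight w I.
  rewrite /weight; under eq_bigr => v _ do rewrite big_mkcond /=.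
  rewrite exchange_big /= [leRHS]big_mkcond; apply: ler_sum => x _.
  rewrite IE; case: exists_inP => [[v vF xv]|no]; last first.
    by rewrite big1 // => v vF; case: ifP => // xv; case: no; exists v.
  rewrite (bigD1 v) //= xv big1 ?addr0 // => v' /andP[v'F v'v].
  case: ifP => // xv'; move: vF v'F; rewrite !inE => /andP[vC _] /andP[v'C _].
  have [_ /(_ erefl) vv'] := sp v v' x x vC v'C xv xv'.
  by rewrite vv' eqxx in v'v.
have rem : weight w S <= weight w (turn b C S) - weight w I +
    \sum_(v in F) cost b (on S) v.
  have -> : weight w (turn b C S) - weight w I =
      \sum_x (if (x \in S) && (x \notin I) && ~~ [exists u in I, e x u] then w x else 0).
    rewrite /weight [X in X - _]big_mkcond [X in _ - X]big_mkcond -sumrB.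
    apply: eq_bigr => x _; rewrite inE -/I.
    by case: (x \in I); case: (x \in S) => //=; rewrite ?subrr ?subr0.
  rewrite /cost exchange_big -big_split /weight [leLHS]big_mkcond /=.
  apply: ler_sum => x _; rewrite -mulr_sumr /on; case: (x \in S) => /=; last by rewrite mul0r addr0.
  have sum0 : 0 <= \sum_(v in F) (charge b v x)%:R :> rat by apply: sumr_ge0.
  case xI: ((x \notin I) && ~~ [exists u in I, e x u]).
    by rewrite lerDl mulr_ge0.
  rewrite add0r ler_peMr //; suff [v vF cv] : exists2 v, v \in F & (0 < charge b v x)%N.
    rewrite (bigD1 v) //= ler_wpDr ?ler1n ?cv //; by apply: sumr_ge0.
  move/negbT: xI; rewrite negb_and !negbK IE => /orP[/exists_inP[v vF xv]|].
    by exists v => //; apply: charge_inserted.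
  move/exists_inP => [u]; rewrite IE => /exists_inP[v vF uv] xu.
  by exists v => //; apply: charge_gt0; apply/orP; right; apply/exists_inP; exists u.
rewrite sumrB; move: insw rem; lra.
Qed.

Lemma fired_gain b C S v : v \in fired b C S ->
  weight w (inserted b v) * (1 - theta^-1) <= weight w (inserted b v) - cost b (on S) v.
Proof.
rewrite inE => /andP[_ lt]; rewrite mulrBr mulr1 lerD2l lerN2 ler_pdivlMr //.
by rewrite mulrC ltW.
Qed.

Lemma weight_ge0 (A : {set V}) : 0 <= weight w A.
Proof. exact: sumr_ge0. Qed.

Let theta_inv : 0 < 1 - theta^-1.
Proof. by rewrite subr_gt0 invf_lt1. Qed.

Definition local_turns := seq (bool * {set V}).

Definition sweep (ts : local_turns) (S : {set V}) : {set V} :=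
  foldl (fun S t => turn t.1 t.2 S) S ts.

Lemma sweep_independent ts S : (forall t, t \in ts -> spread t.1 t.2) ->
  independent e S -> independent e (sweep ts S).
Proof.
elim: ts S => //= t ts IH S sp iS; apply: IH => [t' t'ts|].
  by apply: sp; rewrite inE t'ts orbT.
by apply: turn_independent => //; apply: sp; rewrite inE eqxx.
Qed.

(* [ad] records everything inserted during the sweep, with multiplicity. *)
Lemma sweep_claims ts S : (forall t, t \in ts -> spread t.1 t.2) ->
  exists ad : V -> rat, [/\ forall x, 0 <= ad x,
    (\sum_x ad x) * (1 - theta^-1) <= weight w (sweep ts S) - weight w S
  & forall t v, t \in ts -> v \in t.2 ->
      weight w (inserted t.1 v) <= theta * cost t.1 (fun x => on S x + ad x) v].
Proof.
elim: ts S => [|[b C] ts IH] S sp /=.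
  by exists (fun _ => 0); split => //; rewrite big1 // mul0r subrr.
have spb : spread b C by apply: (sp (b, C)); rewrite inE eqxx.
have [t' t'ts|ad1 [ad0 gain1 claim1]] := IH (turn b C S).
  by apply: sp; rewrite inE t'ts orbT.
exists (fun x => ad1 x + on (insertions b C S) x); split.
- by move=> x; rewrite addr_ge0 // on_ge0.
- rewrite big_split /= sum_on mulrDl.
  have gain0 : weight w (insertions b C S) * (1 - theta^-1) <=
      weight w (turn b C S) - weight w S.
    apply: le_trans (turn_gain S spb).
    apply: (@le_trans _ _ (\sum_(v in fired b C S)
        weight w (inserted b v) * (1 - theta^-1))).
      rewrite -mulr_suml ler_pM2r // /weight.
      under [leRHS]eq_bigr => v _ do rewrite big_mkcond /=.
      rewrite exchange_big /= [leLHS]big_mkcond; apply: ler_sum => x _.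
      have sum0 (P : pred V) : 0 <= \sum_(v | P v) (if x \in inserted b v then w x else 0).
        by apply: sumr_ge0 => v _; case: ifP.
      rewrite inE; case: exists_inP => // -[v vF xv].
      by rewrite (bigD1 v) //= xv lerDl.
    by apply: ler_sum => v vF; apply: fired_gain vF.
  move: gain0 gain1; lra.
- move=> t v; rewrite inE => /orP[/eqP ->|tts] vC /=.
    (* A center that stayed quiet satisfies the bound by the definition of [fired]. One that fired
       has its whole insertion recorded in [ad], and each inserted node is charged at least once. *)
    case vF: (v \in fired b C S); last first.
      move/negbT: vF; rewrite inE vC /= -leNgt => /le_trans -> //.
      by rewrite ler_pM2l //; apply: le_cost => x; rewrite lerDl addr_ge0 // on_ge0.
    have cost0 : weight w (inserted b v) <= cost b (fun x => on S x + (ad1 x + on (insertions b C S) x)) v.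
      rewrite /weight /cost big_mkcond; apply: ler_sum => x _.
      have sgx : 0 <= on S x + (ad1 x + on (insertions b C S) x).
        by rewrite !addr_ge0 ?on_ge0.
      case: ifP => xv; last by rewrite mulr_ge0.
      have xI : x \in insertions b C S by rewrite inE; apply/exists_inP; exists v.
      apply: (@le_trans _ _ (on S x + (ad1 x + on (insertions b C S) x))).
        by rewrite [on (insertions _ _ _) x]/on xI addrA lerDr addr_ge0 ?on_ge0.
      by rewrite ler_peMr // ler1n charge_inserted.
    apply: (le_trans cost0); rewrite ler_peMl ?(ltW theta1) //.
    exact: le_trans (weight_ge0 _) cost0.
  apply: le_trans (claim1 t v tts vC) _; rewrite ler_pM2l //; apply: le_cost => x.
  rewrite [ad1 x + _]addrC addrA lerD2r /on [x \in turn _ _ _]inE.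
  case: (x \in insertions b C S) => /=; first by rewrite lerDr; case: ifP.
  by rewrite addr0; case: (x \in S) => //=; case: ifP.
Qed.

Lemma sweep_weight ts S : (forall t, t \in ts -> spread t.1 t.2) ->
  weight w S <= weight w (sweep ts S).
Proof.
move=> sp; have [ad [ad0 gain _]] := sweep_claims S sp.
rewrite -subr_ge0; apply: le_trans gain; rewrite mulr_ge0 ?(ltW theta_inv) //.
exact: sumr_ge0.
Qed.

(** * Approximation ratio of a local optimum *)

Section LocalOptimum.
Variables (D K : nat) (col : V -> nat) (S O : {set V}) (sg : V -> rat).
Hypotheses (D2 : (1 < D)%N) (degD : forall v, (#|neighbors e v| <= D)%N).
Hypotheses (K0 : (0 < K)%N) (colK : forall v, (col v < K)%N).
Hypothesis col_disj : forall v v' u, col v = col v' -> e v u -> e v' u -> v = v'.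
Hypotheses (sg0 : forall x, 0 <= sg x) (sgS : forall x, x \in S -> w x <= sg x).
Hypothesis iO : independent e O.
Hypothesis single_claim : forall v, w v <= theta * cost false sg v.
Hypothesis star_claim : forall v, independent e (neighbors e v) ->
  weight w (neighbors e v) <= theta * cost true sg v.

Let notO u v : u \in O -> v \in O -> e u v = false.
Proof. by move=> uO vO; have /forall_inP/(_ u uO)/forall_inP/(_ v vO)/negbTE := iO. Qed.

(** How often [x] is charged when the single claims of all members of [O] are added. *)
Let cnt x : nat := ((x \in O) + #|neighbors e x :&: O|)%N.

Let cnt_in x : x \in O -> cnt x = 1%N.
Proof.
move=> xO; rewrite /cnt xO; suff -> : neighbors e x :&: O = set0 by rewrite cards0.
by apply/setP => u; rewrite !inE; apply/andP => -[xu uO]; rewrite notO in xu.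
Qed.

Let cnt_le x : (cnt x <= D)%N.
Proof.
case xO: (x \in O); first by rewrite cnt_in // ltnW.
rewrite /cnt xO; apply: leq_trans (degD x).
by rewrite subset_leq_card // subsetIl.
Qed.

Let full : {set V} := [set v in S | cnt v == D].

Let full_sub v : v \in full -> neighbors e v \subset O /\ #|neighbors e v| = D.
Proof.
rewrite inE => /andP[_ /eqP cv].
have vO : v \notin O.
  by apply: contraL D2 => vO; rewrite -cv cnt_in.
move: cv; rewrite /cnt (negbTE vO) add0n => cv.
have le := subset_leq_card (subsetIl (neighbors e v) O).
have dD : #|neighbors e v| = D by apply/eqP; rewrite eqn_leq degD -[X in (X <= _)%N]cv le.
split=> //; apply/setIidPl/eqP; rewrite eqEcard subsetIl /=.
by rewrite cv dD.
Qed.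

(** One star claim replaces the single claims of all neighbors of [v], each of which charges [v], at
    a saving of $\deg(v)-1$ copies of [sg v]. *)
Let cost_star_split v : cost true sg v + (#|neighbors e v|)%:R * sg v =
  \sum_(u in neighbors e v) cost false sg u + sg v.
Proof.
rewrite /cost exchange_big /=.
have pick1 (a : rat) : a * sg v = \sum_x sg x * (a * (x == v)%:R).
  rewrite (bigD1 v) //= eqxx mulr1 mulrC big1 ?addr0 // => x /negbTE ->.
  by rewrite !mulr0.
rewrite (pick1 #|neighbors e v|%:R) -[X in _ = _ + X]mul1r (pick1 1) -!big_split /=.
apply: eq_bigr => x _; rewrite -mulr_sumr -!mulrDr -natrM mul1r -natr_sum -!natrD; congr (_ * _%:R).
rewrite -sum1_card big_distrl /= addnAC -addnA [RHS]addnC; congr addn.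
rewrite [X in (X + _)%N = _](eq_bigl (fun u => e v u)) => [|u]; last by rewrite inE.
rewrite [RHS](eq_bigl (fun u => e v u)) => [|u]; last by rewrite inE.
rewrite -big_split /=; apply: eq_bigr => u vu.
rewrite mul1n; case: (x =P v) => [->|_] /=; last by rewrite add0n andbT.
by rewrite [e u v]eS vu andbF addn0 addnC.
Qed.

(** Single claims over [O] charge each node at most [D] times, and nodes of [S] outside [full] save
    at least one charge. A full node has exactly [D] neighbors, all in [O], so its star claim can
    replace theirs. Stars combined in this way need disjoint neighborhoods; hence only the heaviest
    color class [P] of [full] is used, at the price of the factor [K]. *)
Lemma local_optimum :
  weight w O <= theta * (D%:R * \sum_x sg x - weight w S / K%:R).
Proof.
have [k kK big_k] : exists2 k, (k < K)%N &
    weight w full <= K%:R * weight w [set v in full | col v == k].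
  have [//|no] := pselect (exists2 k, (k < K)%N &
    weight w full <= K%:R * weight w [set v in full | col v == k]).
  have lt k : (k < K)%N -> K%:R * weight w [set v in full | col v == k] < weight w full.
    by move=> kK; rewrite ltNge; apply/negP => ?; apply: no; exists k.
  have : \sum_(0 <= k < K) K%:R * weight w [set v in full | col v == k] <
         \sum_(0 <= k < K) weight w full.
    by apply: ltr_sum_nat => // k /andP[_ kK]; apply: lt.
  rewrite -mulr_sumr sumr_const_nat subn0 -[ltRHS]mulr_natl ltr_pM2l ?ltr0n //.
  suff -> : \sum_(0 <= k < K) weight w [set v in full | col v == k] = weight w full.
    by rewrite ltxx.
  rewrite /weight; under eq_bigr => k _.
    rewrite (eq_bigl (fun v => (v \in full) && (col v == k))); last by move=> v; rewrite inE.
    rewrite big_mkcondr /=.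
    over.
  rewrite exchange_big /=; apply: eq_bigr => v vF; rewrite big_mkord.
  rewrite (bigD1 (Ordinal (colK v))) //= eqxx big1 ?addr0 // => j jv.
  by case: eqP => // cj; case/eqP: jv; apply: val_inj.
set P := [set v in full | col v == k] in big_k.
have PF v : v \in P -> v \in full by rewrite inE => /andP[].
have disjP v v' u : v \in P -> v' \in P -> e v u -> e v' u -> v = v'.
  by rewrite !inE => /andP[_ /eqP cv] /andP[_ /eqP cv']; apply: col_disj; rewrite cv cv'.
pose NP := [set u | [exists v in P, e v u]].
(* Neighborhoods of distinct nodes of [P] are disjoint and contained in [O]. *)
have split_O (F : V -> rat) : \sum_(u in O) F u =
    \sum_(v in P) \sum_(u in neighbors e v) F u + \sum_(u in O :\: NP) F u.
  rewrite (big_setID NP) /= addrC [RHS]addrC; congr (_ + _).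
  under [RHS]eq_bigr => v _ do rewrite big_mkcond /=.
  rewrite exchange_big /= [LHS]big_mkcond; apply: eq_bigr => u _.
  rewrite !inE; case: exists_inP => [[v vP vu]|no]; last first.
    by rewrite andbF big1 // => v vP; rewrite inE; case: ifP => // vu; case: no; exists v.
  have [/subsetP/(_ u) sub _] := full_sub (PF v vP).
  rewrite sub ?inE //= (bigD1 v) //= inE vu big1 ?addr0 // => v' /andP[v'P v'v].
  by rewrite inE; case: ifP => // v'u; rewrite (disjP v v' u) ?eqxx in v'v.
have iN v : v \in P -> independent e (neighbors e v).
  move=> vP; have [/subsetP sub _] := full_sub (PF v vP).
  by apply/forall_inP => x /sub xO; apply/forall_inP => y /sub yO; rewrite notO.
have step1 : weight w O <= theta * (\sum_(v in P) cost true sg v +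
    \sum_(u in O :\: NP) cost false sg u).
  rewrite /weight split_O mulrDr; apply: lerD.
    by rewrite mulr_sumr; apply: ler_sum => v vP; apply: star_claim; apply: iN.
  by rewrite mulr_sumr; apply: ler_sum.
apply: le_trans step1 _; rewrite ler_pM2l //.
have starE : \sum_(v in P) cost true sg v = \sum_(v in P)
    \sum_(u in neighbors e v) cost false sg u - (D%:R - 1) * \sum_(v in P) sg v.
  rewrite mulr_sumr -sumrB; apply: eq_bigr => v vP.
  have [_ dv] := full_sub (PF v vP); have := cost_star_split v; rewrite dv; lra.
have all_single : \sum_(u in O) cost false sg u = \sum_x sg x * (cnt x)%:R.
  rewrite /cost exchange_big; apply: eq_bigr => x _ /=; rewrite -mulr_sumr -natr_sum.
  congr (_ * _%:R); rewrite big_split /= /cnt; congr addn.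
    case xO: (x \in O); last first.
      by rewrite big1 // => u uO; case: eqP => // xu; rewrite xu uO in xO.
    by rewrite (bigD1 x) //= eqxx big1 ?addn0 // => u /andP[_ /negbTE]; rewrite eq_sym => ->.
  rewrite -sum1_card [RHS](eq_bigl (fun u => (u \in O) && e u x)); last first.
    by move=> u; rewrite !inE eS andbC.
  by rewrite big_mkcondr /=; apply: eq_bigr => u _; case: (e u x).
have cnt_bound : \sum_x sg x * (cnt x)%:R <=
    D%:R * (\sum_x sg x) - (weight w S - weight w full).
  have -> : weight w S - weight w full = \sum_x (if (x \in S) && (cnt x != D) then w x else 0).
    rewrite /weight [X in X - _]big_mkcond [X in _ - X]big_mkcond -sumrB.
    apply: eq_bigr => x _; rewrite inE.
    by case: (x \in S) (cnt x == D) => [] [] //=; rewrite ?subrr ?subr0.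
  rewrite mulr_sumr -sumrB; apply: ler_sum => x _.
  have := cnt_le x; rewrite leq_eqVlt; case: eqP => /= [->|_].
    by rewrite andbF subr0 mulrC.
  rewrite -(ler_nat rat) -natr1 andbT => c1; have s0 := sg0 x; have := ler_wpM2l s0 c1.
  rewrite mulrDr mulr1; case: ifP => [/sgS|_]; lra.
have P_le : weight w P <= \sum_(v in P) sg v.
  by apply: ler_sum => v /PF; rewrite inE => /andP[/sgS].
have full_le : weight w full <= weight w S.
  rewrite /weight big_mkcond [leRHS]big_mkcond; apply: ler_sum => x _.
  by rewrite inE; case: (x \in S) => //=; case: ifP.
have := split_O (cost false sg); rewrite all_single => spl.
have D1 : 1 <= D%:R - 1 :> rat by rewrite lerBrDr -(natrD _ 1 1) ler_nat.
have sP0 : 0 <= \sum_(v in P) sg v by apply: sumr_ge0.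
have DP : weight w P <= (D%:R - 1) * \sum_(v in P) sg v.
  by apply: le_trans P_le _; rewrite ler_peMl.
have K1 : 0 < K%:R :> rat by rewrite ltr0n.
have fK : weight w full / K%:R <= weight w P by rewrite ler_pdivrMr // mulrC.
(* The non-full part saves its full weight and the full part at least a fraction $1/K$; weakening
   the former to $1/K$ as well combines them into [weight w S / K%:R]. *)
have SK : (weight w S - weight w full) / K%:R <= weight w S - weight w full.
  by rewrite ler_pdivrMr // ler_peMr ?subr_ge0 // ler1n.
rewrite mulrBl in SK; move: starE spl cnt_bound DP fK SK; lra.
Qed.

End LocalOptimum.
End LocalSearch.

(** * Broadcast programs *)

(* [nact] and [nund] encode the fractional value 0, 1/2 or 1 of a node (see
   [value]); [nball] holds identifiers or colors of nearby nodes, depending on the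
   stage. *)
Record node := Node {
  nid : nat; nwt : rat; nlay : nat; nact : bool; nund : bool; ncol : nat;
  nins : bool; ngood : bool; nstar : bool; nflag : bool;
  nball : seq nat; nwts : seq rat }.

(** Every node broadcasts its entire record in every round, so a program is just a list of update
    functions. *)
Definition step := node -> seq node -> node.

Definition init_node (i : nat) (x : rat) : node :=
  Node i x 0 true true 0 false false false false [::] [::].

(** * Self-delimiting encoding of node records *)

Section Encoding.

Fixpoint bin_fuel (k n : nat) : bitseq :=
  if k is k'.+1 then if n == 0%N then [::] else odd n :: bin_fuel k' n./2 else [::].

Definition bin n := bin_fuel n n.

Lemma bin_fuelK k n : (n <= k)%N ->
  foldr (fun (b : bool) m => (b + m.*2)%N) 0%N (bin_fuel k n) = n.
Proof.
elim: k n => [|k IH] n /=; first by rewrite leqn0 => /eqP.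
case: eqP => [->|] //= n0 nk; rewrite IH ?odd_double_half //.
by have := odd_double_half n; lia.
Qed.

Lemma bin_inj : injective bin.
Proof. by move=> n m E; rewrite -(bin_fuelK (leqnn n)) -/(bin n) E bin_fuelK. Qed.

Lemma size_bin_fuel L k n : (n < 2 ^ L)%N -> (size (bin_fuel k n) <= L)%N.
Proof.
elim: L k n => [|L IH] [|k] n //=; first by rewrite expn0 ltnS leqn0 => ->.
case: eqP => //= _ nL; rewrite ltnS IH //.
by move: nL; rewrite expnS; have := odd_double_half n; lia.
Qed.

(** Each digit is announced by [true]. After [false], the next bit tells the end of a number
    ([true]) from the end of a list ([false]), so concatenations can be parsed uniquely. *)
Definition enc_nat n : bitseq := flatten [seq [:: true; b] | b <- bin n] ++ [:: false; true].

Definition enc_seq (s : seq nat) : bitseq := flatten (map enc_nat s) ++ [:: false; false].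

Lemma enc_nat_cancel n m s t :
  flatten [seq [:: true; b] | b <- bin n] ++ [:: false, true & s] =
  flatten [seq [:: true; b] | b <- bin m] ++ [:: false, true & t] ->
  n = m /\ s = t.
Proof.
move=> E; suff [/bin_inj -> ->] : bin n = bin m /\ s = t by [].
elim: (bin n) (bin m) E => [|b x IH] [|b' y] //=; first by case.
by case=> <- /IH [-> ->].
Qed.

Lemma enc_seq_cancel u v s t : enc_seq u ++ s = enc_seq v ++ t -> u = v /\ s = t.
Proof.
rewrite /enc_seq -!catA; elim: u v => [|x u IH] [|y v] //=; first by case.
- by rewrite /enc_nat -!catA; case: (bin y).
- by rewrite /enc_nat -!catA; case: (bin x).
- by rewrite -!catA => /enc_nat_cancel[-> /IH[-> ->]].
Qed.

Lemma size_enc_seq L s : all (fun n => (n < 2 ^ L)%N) s ->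
  (size (enc_seq s) <= size s * (2 * L + 2) + 2)%N.
Proof.
rewrite /enc_seq size_cat leq_add2r; elim: s => //= x s IH /andP[xL sL].
rewrite size_cat mulSn leq_add ?IH // /enc_nat size_cat leq_add2r.
have := size_bin_fuel x xL; rewrite -/(bin x).
by elim: (bin x) L {xL IH sL} => //= b y IHy [|L] //= /IHy; lia.
Qed.

Definition rat_nats (x : rat) : seq nat :=
  [:: `|numq x|%N; nat_of_bool (numq x < 0)%R; `|denq x|%N].

Lemma rat_nats_inj x y : rat_nats x = rat_nats y -> x = y.
Proof.
case=> En Es Ed; rewrite -(divq_num_den x) -(divq_num_den y).
have -> : numq x = numq y.
  rewrite (intEsign (numq x)) (intEsign (numq y)) En.
  by move: Es; case: (numq x < 0); case: (numq y < 0).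
suff -> : denq x = denq y by [].
by rewrite -(gtz0_abs (denq_gt0 x)) -(gtz0_abs (denq_gt0 y)) Ed.
Qed.

Lemma flatten_rat_nats_inj s t :
  flatten (map rat_nats s) = flatten (map rat_nats t) -> s = t.
Proof.
elim: s t => [|x s IH] [|y t] //=; case=> e1 e2 e3 /IH ->.
by rewrite (@rat_nats_inj x y) // /rat_nats e1 e2 e3.
Qed.

Definition node_nats r : seq nat :=
  [:: nid r, nlay r, nat_of_bool (nact r), nat_of_bool (nund r), ncol r,
      nat_of_bool (nins r), nat_of_bool (ngood r), nat_of_bool (nstar r),
      nat_of_bool (nflag r) & rat_nats (nwt r)].

Definition encode (r : node) : bitseq :=
  enc_seq (node_nats r) ++
  (enc_seq (nball r) ++ (enc_seq (flatten (map rat_nats (nwts r))) ++ [::])).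

Lemma encode_inj : injective encode.
Proof.
move=> r r' /enc_seq_cancel[E] /enc_seq_cancel[Eb] /enc_seq_cancel[/flatten_rat_nats_inj Ew _].
have bool_inj (b b' : bool) : (b : nat) = b' -> b = b' by case: b; case: b'.
have wE : nwt r = nwt r' by apply: rat_nats_inj; case: E => *; rewrite /rat_nats; congruence.
case: E => E1 E2 /bool_inj E3 /bool_inj E4 E5 /bool_inj E6 /bool_inj E7 /bool_inj E8 /bool_inj E9 _ _ _.
by case: r r' Eb Ew wE E1 E2 E3 E4 E5 E6 E7 E8 E9 => ? ? ? ? ? ? ? ? ? ? ? ? [] /=; congruence.
Qed.

(** An inverse by choice is legitimate, since local computation is unrestricted in the model. *)
Definition decode (b : bitseq) : node :=
  if pselect (exists r, encode r = b) is left H then sval (cid H) else init_node 0 0.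

Lemma encodeK : cancel encode decode.
Proof.
move=> r; rewrite /decode; case: pselect => [H|]; last by case; exists r.
by apply: encode_inj; rewrite (svalP (cid H)).
Qed.

Definition small_rat L (x : rat) : bool := all (fun n => (n < 2 ^ L)%N) (rat_nats x).

Definition small (L l : nat) (r : node) : bool :=
  [&& (nid r < 2 ^ L)%N, small_rat L (nwt r), (nlay r < 2 ^ L)%N, (ncol r < 2 ^ L)%N,
      (size (nball r) <= l)%N, all (fun n => (n < 2 ^ L)%N) (nball r),
      (size (nwts r) <= l)%N & all (small_rat L) (nwts r)].

(** Twelve fixed numbers, at most [l] numbers in [nball] and three per listed weight take at most
    $2L+2$ bits each; the three list terminators raise 12 to 15. *)
Lemma size_encode L l r : (0 < L)%N -> small L l r ->
  (size (encode r) <= (15 + 4 * l) * (2 * L + 2))%N.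
Proof.
move=> L0 /and5P[h1 h2 h3 h4 /and4P[h5 h6 h7 h8]].
have b1 (b : bool) : (b < 2 ^ L)%N.
  by apply: leq_ltn_trans (leq_b1 b) _; rewrite -[1%N](expn0 2) ltn_exp2l.
have s1 : all (fun n => (n < 2 ^ L)%N) (node_nats r).
  by move: h2; rewrite /small_rat /= h1 h3 h4 !b1 => /and4P[-> _ -> _].
have s3 : all (fun n => (n < 2 ^ L)%N) (flatten (map rat_nats (nwts r))).
  by elim: (nwts r) h8 => //= x s IH /andP[hx /IH]; move: hx; rewrite /small_rat /= => /and4P[-> -> -> _].
have sz3 : size (flatten (map rat_nats (nwts r))) = (3 * size (nwts r))%N.
  by elim: (nwts r) => //= x s ->; lia.
have := size_enc_seq s1; have := size_enc_seq h6; have := size_enc_seq s3.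
have sz1 : size (node_nats r) = 12%N by [].
rewrite sz1 sz3 /encode cats0 size_cat [size (enc_seq (nball r) ++ _)]size_cat.
set A := size (enc_seq (node_nats r)); set B := size (enc_seq (nball r)).
set C := size (enc_seq (flatten _)).
have : (3 * size (nwts r) * (2 * L + 2) <= 3 * l * (2 * L + 2))%N.
  by rewrite leq_mul // leq_mul.
have : (size (nball r) * (2 * L + 2) <= l * (2 * L + 2))%N by rewrite leq_mul.
rewrite mulnDl -!mulnA; move: (l * (2 * L + 2))%N (size (nball r) * _)%N (size (nwts r) * _)%N => x y z; lia.
Qed.

End Encoding.

(** * Synchronous execution of programs *)

Section Running.
Variables (V : finType) (ports : V -> seq V).

Definition round (f : step) (cfg : V -> node) : V -> node :=
  fun v => f (cfg v) [seq cfg u | u <- ports v].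

Definition run (fs : seq step) (cfg : V -> node) : V -> node :=
  foldl (fun c f => round f c) cfg fs.

Lemma run_cat fs gs cfg : run (fs ++ gs) cfg = run gs (run fs cfg).
Proof. by rewrite /run foldl_cat. Qed.

(** Required of all small records, reachable or not, which separates message sizes from correctness.
    Truncated lists and total searches make this possible. *)
Definition small_step L l (f : step) : Prop :=
  forall r ns, small L l r -> all (small L l) ns -> small L l (f r ns).

Definition small_prog L l (fs : seq step) : Prop :=
  forall i, (i < size fs)%N -> small_step L l (nth (fun r _ => r) fs i).

Lemma small_prog_cat L l fs gs :
  small_prog L l fs -> small_prog L l gs -> small_prog L l (fs ++ gs).
Proof.
move=> hf hg i; rewrite size_cat nth_cat => isz; case: ltnP => ifs; first exact: hf.
by apply: hg; rewrite ltn_subLR.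
Qed.

Lemma small_prog_cons L l f fs :
  small_step L l f -> small_prog L l fs -> small_prog L l (f :: fs).
Proof. by move=> hf hg [|i] //= /hg. Qed.

Lemma small_prog_nil L l : small_prog L l [::]. Proof. by []. Qed.

Lemma small_prog_map L l (f : nat -> step) s :
  (forall i, i \in s -> small_step L l (f i)) -> small_prog L l [seq f i | i <- s].
Proof.
move=> h; elim: s h => //= x s IH h; apply: small_prog_cons; first by apply: h; rewrite inE eqxx.
by apply: IH => i si; apply: h; rewrite inE si orbT.
Qed.

Lemma small_prog_flatten L l (f : nat -> seq step) s :
  (forall i, i \in s -> small_prog L l (f i)) ->
  small_prog L l (flatten [seq f i | i <- s]).
Proof.
move=> h; elim: s h => //= x s IH h; apply: small_prog_cat; first by apply: h; rewrite inE eqxx.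
by apply: IH => i si; apply: h; rewrite inE si orbT.
Qed.

Lemma small_run L l fs cfg t : small_prog L l fs -> (forall v, small L l (cfg v)) ->
  forall v, small L l (run (take t fs) cfg v).
Proof.
move=> sf sc; elim: t => [|t IH] v; first by rewrite take0.
case: (ltnP t (size fs)) => tfs; last first.
  by have := IH v; rewrite !take_oversize // ltnW.
rewrite (take_nth (fun r _ => r)) // -cats1 run_cat /= /round.
by apply: sf => //; rewrite all_map; apply/allP => u _ /=.
Qed.

End Running.

(** The round counter in the state makes all nodes halt together, so no running node ever has to
    decode the silence of a halted neighbor. *)
Definition broadcast_algorithm (prog : nat -> nat -> seq step) : congest_algorithm :=
  @CongestAlgorithm (nat * nat * nat * node)%type
    (fun n a _ i x => (n, a, 0%N, init_node i x))
    (fun s _ => encode s.2)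
    (fun s ms => let: (n, a, t, r) := s in
       (n, a, t.+1, nth (fun r _ => r) (prog n a) t r (map decode ms)))
    (fun s => let: (n, a, t, r) := s in
       if (size (prog n a) <= t)%N then Some (nins r) else None).

Section BroadcastCorrect.
Variables (V : finType) (w : V -> rat) (id : V -> nat) (ports : V -> seq V).
Variables (prog : nat -> nat -> seq step) (a : nat).

Local Notation P := (prog #|V| a).
Local Notation cfg0 := (fun v => init_node (id v) (w v)).
Local Notation A := (broadcast_algorithm prog).

Lemma exec_broadcast t v : (t <= size P)%N ->
  exec w A a id ports t v = (#|V|, a, t, run ports (take t P) cfg0 v).
Proof.
elim: t v => [|t IH] v tP; first by rewrite take0.
have tP' := ltnW tP; rewrite /= IH //= leqNgt tP /=.
rewrite (take_nth (fun r _ => r)) // -cats1 run_cat /= /round.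
congr (_, _, _, _); congr (nth _ _ _ _ _).
rewrite -map_comp; apply: eq_map => u /=.
by rewrite /outgoing IH //= leqNgt tP /= encodeK.
Qed.

Lemma exec_halted t v : (size P <= t)%N ->
  exec w A a id ports t v = (#|V|, a, size P, run ports P cfg0 v).
Proof.
move=> /subnK <-; elim: (t - size P)%N => [|k IH].
  by rewrite exec_broadcast // take_size.
by rewrite addSn /= IH /= leqnn.
Qed.

Lemma broadcast_computes :
  computes_in w A a id ports (size P) [set v | nins (run ports P cfg0 v)].
Proof. by move=> v; rewrite exec_halted //= leqnn inE. Qed.

Lemma broadcast_message_bound (R : realType) (b : R) L l : (0 < L)%N ->
  small_prog L l P -> (forall v, small L l (cfg0 v)) ->
  ((15 + 4 * l) * (2 * L + 2))%:R <= b -> message_bound w A a id ports b.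
Proof.
move=> L0 sP s0 hb t v i _; rewrite /outgoing; case: (ltnP t (size P)) => tP.
  have tP' := ltnW tP; rewrite exec_broadcast //= leqNgt tP /=.
  by apply: le_trans hb; rewrite ler_nat; apply: size_encode => //; apply: small_run.
rewrite exec_halted //= leqnn /=; apply: le_trans hb; exact: ler0n.
Qed.

End BroadcastCorrect.

(** * Fractional rounding along a low out-degree orientation *)

Definition set_layer t r :=
  Node (nid r) (nwt r) t false (nund r) (ncol r) (nins r) (ngood r) (nstar r) (nflag r)
       (nball r) (nwts r).
Definition set_act b u r :=
  Node (nid r) (nwt r) (nlay r) b u (ncol r) (nins r) (ngood r) (nstar r) (nflag r)
       (nball r) (nwts r).
Definition set_col c bl r :=
  Node (nid r) (nwt r) (nlay r) (nact r) (nund r) c (nins r) (ngood r) (nstar r) (nflag r)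
       bl (nwts r).
Definition set_ins b r :=
  Node (nid r) (nwt r) (nlay r) (nact r) (nund r) (ncol r) b (ngood r) (nstar r) (nflag r)
       (nball r) (nwts r).

Definition peel (d t : nat) : step := fun r ns =>
  if nact r && (count nact ns <= d)%N then set_layer t r else r.

Definition wake : step := fun r _ => set_act true true r.

Definition start_halving : step := fun r _ => set_col (nid r) [::] (set_act (nact r) true r).

Definition pair_weight (r r' : node) : rat :=
  (if (nlay r <= nlay r')%N then nwt r else 0) + (if (nlay r' <= nlay r)%N then nwt r' else 0).

Definition defective (h : nat -> nat -> nat -> nat) (m : nat) : step := fun r ns =>
  let tot := \sum_(r' <- ns | nact r') pair_weight r r' in
  let cf al := \sum_(r' <- ns | nact r' &&
     ((ncol r' != ncol r) && (h m al (ncol r') == h m al (ncol r)))) pair_weight r r' in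
  let al := first_below (fun al => cf al * (2 ^ m)%:R <= 2%:R * tot) (2 ^ m) in
  set_col (al * 2 ^ m + h m al (ncol r))%N [::] r.

Definition value (r : node) : rat := if nact r then if nund r then 1 / 2%:R else 1 else 0.

Definition decide (b : rat) (k : nat) : step := fun r ns =>
  set_act (if [&& nact r, nund r & ncol r == k]
           then 0 <= nwt r - b * \sum_(r' <- ns) pair_weight r r' * value r'
           else nact r)
          (nund r && (ncol r != k)) r.

Definition select : step := fun r ns =>
  set_ins (nact r && ~~ has (fun r' => nact r' && (nlay r <= nlay r')%N) ns) r.

(** The parameter runs from $s+d$ down to $s+1$. With [1 < s] all values are at least 3, as needed
    for $2m$-bit colors to fit into $3(m-1)$ bits. *)
Fixpoint countdown (f : nat -> seq step) s d : seq step :=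
  if d is d'.+1 then f (s + d)%N ++ countdown f s d' else [::].

Definition halve h s d b : seq step :=
  start_halving :: countdown (fun m => [:: defective h m]) s d ++
  [seq decide b k | k <- iota 0 (2 ^ (3 * s))].

Definition rounding h s d g p m : seq step :=
  flatten [seq halve h s d (p * g ^+ j.+1) | j <- iota 0 m].

Definition phase1 h s d g m (n a : nat) : seq step :=
  [seq peel (4 * a) t | t <- iota 0 (trunc_log 2 n).+1] ++
  wake :: rounding h s d g (1 / (8 * a)%:R) m ++ [:: select].

Section Neighborhoods.
Variables (V : finType) (e : rel V) (ports : V -> seq V).
Hypothesis hp : port_numbering e ports.
Variable cfg : V -> node.

Lemma neighbor_sum v (P : pred node) (F : node -> rat) :
  \sum_(r <- [seq cfg u | u <- ports v] | P r) F r =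
  \sum_(u | e v u && P (cfg u)) F (cfg u).
Proof.
rewrite big_map (perm_big _ (hp v)) /= big_enum_cond.
by apply: eq_bigl => u; rewrite inE.
Qed.

Lemma neighbor_count v (P : pred node) :
  count P [seq cfg u | u <- ports v] = #|[set u | e v u && P (cfg u)]|.
Proof.
rewrite count_map (permP (hp v)) -size_filter -filter_predI cardE; congr size.
rewrite /enum_mem; apply: eq_filter => u.
by rewrite !inE andbC.
Qed.

Lemma neighbor_has v (P : pred node) :
  has P [seq cfg u | u <- ports v] = [exists u, e v u && P (cfg u)].
Proof.
rewrite has_map; apply/hasP/existsP => -[u].
  by rewrite (perm_mem (hp v)) mem_enum inE => vu /= Pu; exists u; rewrite vu.
move=> /andP[vu Pu]; exists u => //.
by rewrite (perm_mem (hp v)) mem_enum inE.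
Qed.

Lemma neighbor_size v : size (ports v) = #|neighbors e v|.
Proof. by rewrite (perm_size (hp v)) cardE. Qed.

End Neighborhoods.

Section PhaseOne.
Variables (V : finType) (e : rel V) (w : V -> rat) (id : V -> nat) (ports : V -> seq V).
Hypotheses (eS : symmetric e) (eI : irreflexive e) (w0 : forall v, 0 <= w v).
Hypotheses (hp : port_numbering e ports) (id_inj : injective id).

Section Peeling.
Variable a : nat.
Hypothesis sparse : forall U : {set V},
  (\sum_(v in U) #|[set u in U | e v u]| <= 2 * a * #|U|)%N.

(** Active nodes count as out-neighbors of peeled ones because they will receive later layers. A
    survivor has more than $4a$ active neighbors while the average active degree is at most $2a$, so
    at most half of the active nodes survive a round. *)
Lemma peeling t (cfg := run ports [seq peel (4 * a) i | i <- iota 0 t]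
                            (fun v => init_node (id v) (w v))) :
  [/\ forall v, nid (cfg v) = id v /\ nwt (cfg v) = w v,
      forall v, ~~ nact (cfg v) -> (nlay (cfg v) < t)%N /\
        (#|[set u | e v u && (nact (cfg u) || (nlay (cfg v) <= nlay (cfg u)))]| <= 4 * a)%N
    & (#|[set v | nact (cfg v)]| * 2 ^ t <= #|V|)%N].
Proof.
rewrite /cfg {cfg}; elim: t => [|t]; first by split => //=; rewrite muln1 max_card.
rewrite -[in iota 0 t.+1]addn1 iotaD map_cat run_cat /= add0n.
set cfg := run _ _ _ => -[st inv card_act].
have newE v : round ports (peel (4 * a) t) cfg v =
  if nact (cfg v) && (#|[set u | e v u && nact (cfg u)]| <= 4 * a)%N
  then set_layer t (cfg v) else cfg v.
  by rewrite /round /peel (neighbor_count hp).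
split.
- by move=> v; rewrite newE; case: ifP => _; apply: (st v).
- have old_lay u : nact (cfg u) = false -> (nlay (cfg u) < t)%N.
    by move=> au; have [] := inv u (negbT au).
  move=> v; rewrite newE; case: ifP => [/andP[av few] _|old av].
    split=> //=; apply: leq_trans few; apply: subset_leq_card.
    apply/subsetP => u; rewrite !inE newE => /andP[-> /=].
    case au: (nact (cfg u)) => //=.
    by rewrite au leqNgt old_lay.
  have [lt few] := inv v av; split; first exact: ltnW.
  apply: leq_trans few; apply: subset_leq_card.
  apply/subsetP => u; rewrite !inE newE => /andP[-> /=].
  by case: ifP => [/andP[-> //]|_].
- set U := [set v | nact (cfg v)] in card_act.
  set B := [set v | _]; have BU : B \subset U.
    by apply/subsetP => v; rewrite !inE newE; case: ifP => [/andP[->]|].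
  have Bdeg v : v \in B -> (4 * a < #|[set u in U | e v u]|)%N.
    rewrite inE newE; case: ifP => //= + av; rewrite av /= => /negbT; rewrite -ltnNge => lt.
    apply: (leq_trans lt); apply: subset_leq_card; apply/subsetP => u.
    by rewrite !inE andbC.
  have : ((4 * a).+1 * #|B| <= 2 * a * #|U|)%N.
    apply: leq_trans (sparse U); rewrite (big_setID B) /= (setIidPr BU).
    rewrite mulnC -sum_nat_const; apply: leq_trans (leq_addr _ _).
    exact: leq_sum.
  by rewrite expnS; move: (2 ^ t)%N card_act => x; nia.
Qed.

Lemma peeled (cfg := run ports [seq peel (4 * a) i | i <- iota 0 (trunc_log 2 #|V|).+1]
                         (fun v => init_node (id v) (w v))) :
  exists lay : V -> nat,
    (forall v, [/\ nid (cfg v) = id v, nwt (cfg v) = w v & nlay (cfg v) = lay v]) /\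
    (forall A v, (out_degree e lay A v <= 4 * a)%N).
Proof.
have [st inv card_act] := peeling (trunc_log 2 #|V|).+1.
rewrite -/cfg in st inv card_act.
have noact v : ~~ nact (cfg v).
  apply/negP => av; have : (0 < #|[set v | nact (cfg v)]|)%N.
    by apply/card_gt0P; exists v; rewrite inE.
  have := trunc_log_ltn #|V| (isT : (1 < 2)%N).
  move: (2 ^ _)%N (#|[set _ | _]|) card_act => x y; nia.
exists (fun v => nlay (cfg v)); split=> [v|A v]; first by have [] := st v.
have [_ few] := inv v (noact v); apply: leq_trans few; apply: subset_leq_card.
by apply/subsetP => u; rewrite !inE => /and3P[_ -> ->]; rewrite orbT.
Qed.

End Peeling.

Section Halve.
Variable lay : V -> nat.
Variables (h : nat -> nat -> nat -> nat) (s : nat).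
Hypotheses (hash_h : hash_family h) (s2 : (1 < s)%N).

Definition fixed (cfg : V -> node) : Prop :=
  forall v, [/\ nid (cfg v) = id v, nwt (cfg v) = w v & nlay (cfg v) = lay v].

Definition acting (cfg : V -> node) : {set V} := [set v | nact (cfg v)].

Lemma pair_weightE cfg v u : fixed cfg -> pair_weight (cfg v) (cfg u) = edge_weight w lay v u.
Proof. by move=> st; rewrite /pair_weight; have [_ -> ->] := st v; have [_ -> ->] := st u. Qed.

(** The round with parameter $m$ adds error $2\cdot2^{-m}=2(2^{-(m-1)}-2^{-m})$, so the errors
    telescope. *)
Lemma defective_loop d cfg (A := acting cfg) :
    fixed cfg -> (forall v, nund (cfg v)) ->
    (forall v, ncol (cfg v) < 2 ^ (3 * (s + d)))%N ->
  let cfg' := run ports (countdown (fun m => [:: defective h m]) s d) cfg in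
  [/\ fixed cfg', acting cfg' = A, forall v, nund (cfg' v),
      forall v, (ncol (cfg' v) < 2 ^ (3 * s))%N
    & mono e w lay A (ncol \o cfg') <= mono e w lay A (ncol \o cfg) +
        2%:R * ((2 ^ s)%:R^-1 - (2 ^ (s + d))%:R^-1) * mass e w lay A].
Proof.
rewrite /A {A}; elim: d cfg => [|d IH] cfg st und cl /=.
  by rewrite addn0 in cl *; split => //; rewrite subrr mulr0 mul0r addr0.
set m := (s + d.+1)%N; set A := acting cfg.
have m0 : (0 < m)%N by rewrite /m addnS.
set cfg1 := round ports (defective h m) cfg.
pose al v := first_below (fun al => conflict e w lay h m A (ncol \o cfg) v al * (2 ^ m)%:R <=
    2%:R * incident e w lay A v) (2 ^ m).
have cfg1E v : cfg1 v = set_col (recolor h m (ncol \o cfg) v (al v)) [::] (cfg v).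
  rewrite /cfg1 /round /defective; set al' := first_below _ _.
  suff -> : al' = al v by [].
  rewrite /al'; congr first_below; apply/funext => x.
  rewrite !(neighbor_sum hp) /conflict /incident; congr (_ * _ <= _ * _).
    apply: eq_big => [u|u _]; last exact: pair_weightE.
    by rewrite inE; case: (e v u); rewrite //= andbF.
  apply: eq_big => [u|u _]; last exact: pair_weightE.
  by rewrite inE andbC.
have st1 : fixed cfg1 by rewrite /fixed => v; rewrite cfg1E; apply: (st v).
have und1 v : nund (cfg1 v) by rewrite cfg1E /= und.
have act1 : acting cfg1 = A by apply/setP => v; rewrite !inE cfg1E.
have cl1 v : (ncol (cfg1 v) < 2 ^ (3 * (s + d)))%N.
  rewrite cfg1E /=; apply: leq_trans (recolor_lt hash_h m0 _ _ (first_below_lt _ _)) _.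
    by rewrite expn_gt0.
  by rewrite leq_exp2l // /m; lia.
have [st' act' und' cl' mono'] := IH cfg1 st1 und1 cl1.
rewrite act1 in act' mono'; split => //; apply: le_trans mono' _.
have step : mono e w lay A (ncol \o cfg1) <= mono e w lay A (ncol \o cfg) +
    2%:R / (2 ^ m)%:R * mass e w lay A.
  have -> : ncol \o cfg1 = (fun v => recolor h m (ncol \o cfg) v (al v)).
    by apply/funext => v; rewrite [LHS]/comp cfg1E.
  apply: mono_recolor => // v vA.
  apply: (@first_belowP (fun x => conflict e w lay h m A (ncol \o cfg) v x *
    (2 ^ m)%:R <= 2%:R * incident e w lay A v)).
  by apply: low_conflict => // u _; apply: cl.
have -> : (2 ^ (s + d))%:R^-1 = 2%:R / (2 ^ m)%:R :> rat.
  rewrite /m addnS expnS natrM invfM mulrA mulfV ?mul1r //.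
apply: le_trans (lerD step (lexx _)) _; rewrite le_eqVlt; apply/orP; left; apply/eqP; ring.
Qed.

Lemma decide_loop b (A : {set V}) cfg k : 0 <= b ->
    fixed cfg -> acting cfg = A -> (forall v, nund (cfg v)) ->
  let cfg' := run ports [seq decide b i | i <- iota 0 k] cfg in
  [/\ fixed cfg', forall v, nact (cfg' v) -> v \in A,
      forall v, nund (cfg' v) -> (k <= ncol (cfg v))%N,
      forall v, ncol (cfg' v) = ncol (cfg v)
    & relaxed e w lay b (frac (nact \o cfg) (nund \o cfg)) -
        b / 8%:R * \sum_(0 <= i < k) class_mass e w lay A (ncol \o cfg) i <=
      relaxed e w lay b (frac (nact \o cfg') (nund \o cfg'))].
Proof.
move=> b0 st actA und; elim: k => [|k].
  rewrite /= big_nil mulr0 subr0; split => // v av; by rewrite -actA inE.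
rewrite -[in iota 0 k.+1]addn1 iotaD map_cat run_cat /= add0n.
set cfg1 := run _ _ cfg => -[st1 act1 und1 col1 rel1].
set cfg2 := round _ _ _.
have slopeE v : nwt (cfg1 v) - b * \sum_(r' <- [seq cfg1 u | u <- ports v])
    pair_weight (cfg1 v) r' * value r' = slope e w lay b (frac (nact \o cfg1) (nund \o cfg1)) v.
  rewrite (neighbor_sum hp _ _ predT) /slope; have [_ -> _] := st1 v; congr (_ - _ * _).
  apply: eq_big => [u|u _]; first by rewrite andbT.
  by rewrite pair_weightE.
split.
- by move=> v; apply: (st1 v).
- move=> v; rewrite /cfg2 /round /=; case: ifP => [/and3P[av _ _] _|_]; exact: act1.
- move=> v; rewrite /cfg2 /round /= => /andP[uv ck].
  by rewrite ltn_neqAle und1 // andbT eq_sym -col1.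
- exact: col1.
- rewrite big_nat_recr //= mulrDr opprD addrA.
  apply: le_trans (lerD rel1 (lexx _)) _.
  apply: round_class => // v /=.
    by rewrite /cfg2 /round /= slopeE col1.
  by rewrite col1.
Qed.

(** Starting at 1/2 gives $w(A)/2$ minus $gp/8$ times the mass, and rounding loses another $gp/8$
    times the monochromatic mass, a fraction at most $2/2^s$ of the mass. The hypothesis on [g] says
    precisely that both losses fit into $p/4$ times the mass. *)
Lemma halve_potential d g p cfg (A := acting cfg) :
    fixed cfg -> (forall v, id v < 2 ^ (3 * (s + d)))%N -> 0 <= p -> 0 <= g ->
    g * (1 + 2%:R / (2 ^ s)%:R) <= 2%:R ->
  let cfg' := run ports (halve h s d (g * p)) cfg in
  fixed cfg' /\
  potential e w lay A p / 2%:R <= potential e w lay (acting cfg') (g * p).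
Proof.
move=> st idl p0 g0 gs; rewrite /halve /=.
set cfg0 := round _ start_halving cfg.
have st0 : fixed cfg0 by move=> v; apply: (st v).
have act0 : acting cfg0 = A by apply/setP => v; rewrite !inE.
have und0 v : nund (cfg0 v) by [].
have col0 v : (ncol (cfg0 v) < 2 ^ (3 * (s + d)))%N.
  by rewrite /cfg0 /round /=; have [-> _ _] := st v.
have b0 : 0 <= g * p by rewrite mulr_ge0.
have [st1 act1 und1 col1 mono1] := defective_loop st0 und0 col0.
rewrite act0 in act1 mono1; rewrite run_cat; set cfg1 := run _ _ cfg0 in st1 act1 und1 col1 mono1 *.
have [st2 act2 und2 col2 rel2] := decide_loop (2 ^ (3 * s)) b0 st1 act1 und1.
set cfg2 := run _ _ cfg1 in st2 act2 und2 col2 rel2 *; split => //.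
rewrite (relaxed_half e w lay (g * p) (A := A)) in rel2; last 2 first.
- by move=> v; rewrite -act1 inE.
- by move=> v _; apply: und1.
rewrite (relaxed_integral w lay eS (g * p) (A := acting cfg2)) in rel2; last 2 first.
- by move=> v; rewrite inE.
- by move=> v _; apply/negP => /und2; rewrite leqNgt col1.
apply: le_trans rel2; rewrite sum_class_mass; last by move=> v _; apply: col1.
(* Every halving restarts from the identifiers, under which no edge is monochromatic. *)
have mono0 : mono e w lay A (ncol \o cfg0) = 0.
  rewrite /mono big1 // => v _; rewrite big1 // => u /andP[_ /andP[vu /eqP]] /=.
  have [-> _ _] := st u; have [-> _ _] := st v => /id_inj uv.
  by rewrite uv eI in vu.
have mass0 := mass_ge0 e lay w0 A.
have inv0 : 0 <= (2 ^ (s + d))%:R^-1 :> rat by rewrite invr_ge0.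
have bound : mono e w lay A (ncol \o cfg1) <= 2%:R / (2 ^ s)%:R * mass e w lay A.
  apply: le_trans mono1 _; rewrite mono0 add0r ler_wpM2r // ler_pM2l //.
  by rewrite lerBlDr lerDl.
have -> : potential e w lay A p = weight w A - p / 2%:R * mass e w lay A.
  by rewrite /potential (mass_out_degree w lay eS); field.
have step1 := ler_wpM2l b0 bound.
have step2 := ler_wpM2l (mulr_ge0 p0 mass0) gs.
move: step1 step2; move: (mass _ _ _ _) (mono _ _ _ _ _) (weight _ _) (2%:R / (2 ^ s)%:R).
move=> M X W q step1 step2.
have {step1} : g * p * X <= g * p * q * M by rewrite -[g * p * q * M]mulrA.
have {step2} : g * p * M + g * p * q * M <= 2%:R * p * M by move: step2; lra.
lra.
Qed.

Lemma rounding_potential d g p m cfg (A := acting cfg) :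
    fixed cfg -> (forall v, id v < 2 ^ (3 * (s + d)))%N -> 0 <= p -> 0 <= g ->
    g * (1 + 2%:R / (2 ^ s)%:R) <= 2%:R ->
  let cfg' := run ports (rounding h s d g p m) cfg in
  fixed cfg' /\
  potential e w lay A p <= (2 ^ m)%:R * potential e w lay (acting cfg') (p * g ^+ m).
Proof.
move=> st idl p0 g0 gs; elim: m => [|m].
  by rewrite /= expr0 mulr1 expn0 mul1r.
rewrite /rounding -[in iota 0 m.+1]addn1 iotaD map_cat flatten_cat run_cat /= add0n cats0.
set cfg1 := run _ _ cfg => -[st1 le1].
have pm : 0 <= p * g ^+ m by rewrite mulr_ge0 ?exprn_ge0.
have := halve_potential (cfg := cfg1) st1 idl pm g0 gs.
rewrite mulrCA -exprS => -[st2 le2]; split => //; apply: le_trans le1 _.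
rewrite expnSr natrM -mulrA ler_pM2l; last by rewrite ltr0n expn_gt0.
by rewrite [2%:R * _]mulrC -ler_pdivrMr.
Qed.

End Halve.

(** Out-degree $4a$ at $p=1/(8a)$ costs a factor 2, and each of the [m] halvings another. The
    condition $8a\le g^m$ brings the final parameter to at least 1, where the sinks carry the
    potential. *)
Lemma phase1_correct a h s d g m (cfg := run ports (phase1 h s d g m #|V| a)
      (fun v => init_node (id v) (w v))) (S := [set v | nins (cfg v)]) :
    (forall U : {set V}, (\sum_(v in U) #|[set u in U | e v u]| <= 2 * a * #|U|)%N) ->
    hash_family h -> (1 < s)%N -> (0 < a)%N ->
    (forall v, id v < 2 ^ (3 * (s + d)))%N -> 0 <= g ->
    g * (1 + 2%:R / (2 ^ s)%:R) <= 2%:R -> (8 * a)%:R <= g ^+ m ->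
  [/\ forall v, nid (cfg v) = id v /\ nwt (cfg v) = w v,
      independent e S
    & weight w [set: V] <= (2 ^ m.+1)%:R * weight w S].
Proof.
move=> sparse hh s2 a0 idl g0 gs gm.
have [lay [st0 od]] := peeled sparse.
rewrite /S /cfg {S cfg} /phase1 run_cat /= run_cat.
set cfg0 := run _ _ _ in st0 *; set cfg1 := round _ wake cfg0.
have st1 : fixed lay cfg1 by move=> v; apply: (st0 v).
have act1 : acting cfg1 = [set: V] by apply/setP => v; rewrite !inE.
set p : rat := 1 / (8 * a)%:R.
have a0' : 0 < (8 * a)%:R :> rat by rewrite ltr0n muln_gt0.
have p0 : 0 <= p by rewrite mulr_ge0 ?invr_ge0.
have [st2 le2] := rounding_potential hh s2 m st1 idl p0 g0 gs.
set cfg2 := run _ (rounding _ _ _ _ _ _) cfg1 in st2 le2 *.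
set cfg3 := run ports [:: select] cfg2.
have insE v : nins (cfg3 v) =
    nact (cfg2 v) && ~~ [exists u, [&& e v u, nact (cfg2 u) & (lay v <= lay u)%N]].
  rewrite /cfg3 /= /round /= (neighbor_has hp); congr (_ && ~~ _).
  by apply: eq_existsb => u; have [_ _ ->] := st2 u; have [_ _ ->] := st2 v.
split.
- by move=> v; have [] := st2 v.
- apply/forall_inP => x; rewrite inE insE => /andP[ax /existsPn nx].
  apply/forall_inP => y; rewrite inE insE => /andP[ay /existsPn ny].
  apply/negP => xy; case: (leqP (lay x) (lay y)) => le.
    by have := nx y; rewrite xy ay le.
  by have := ny x; rewrite eS xy ax ltnW.
- have half : weight w [set: V] / 2%:R <= potential e w lay (acting cfg1) p.
    rewrite act1; apply: (potential0 w0 (d := (4 * a)%N)) => //.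
    rewrite /p (_ : (8 * a)%N = 2 * (4 * a))%N; last by lia.
    rewrite natrM invfM mul1r -mulrA mulVf ?mulr1 ?mul1r //.
    by rewrite pnatr_eq0 muln_eq0 negb_or /= -lt0n.
  have sinks : potential e w lay (acting cfg2) (p * g ^+ m) <= weight w [set v | nins (cfg3 v)].
    apply: potential_sinks => // [|v].
      by rewrite /p mul1r mulrC ler_pdivlMr ?mul1r.
    rewrite !inE insE; congr (_ && _); apply/existsPn/idP => [no|/eqP/cards0_eq no u].
      rewrite cards_eq0; apply/eqP/setP => u; rewrite !inE.
      by apply/negbTE; apply: contra (no u) => /and3P[-> -> ->].
    apply/negP => /and3P[vu au le]; move/setP/(_ u): no.
    by rewrite !inE vu au le.
  rewrite expnSr natrM -mulrA mulrCA mulrC -ler_pdivrMr //.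
  apply: le_trans half _; apply: le_trans le2 _.
  by rewrite ler_pM2l // ltr0n expn_gt0.
Qed.

End PhaseOne.

(** * Local improvement among low-degree nodes *)

Definition set_good b r :=
  Node (nid r) (nwt r) (nlay r) (nact r) (nund r) (ncol r) (nins r) b (nstar r) (nflag r)
       (nball r) (nwts r).
Definition set_star b r :=
  Node (nid r) (nwt r) (nlay r) (nact r) (nund r) (ncol r) (nins r) (ngood r) b (nflag r)
       (nball r) (nwts r).
Definition set_flag b r :=
  Node (nid r) (nwt r) (nlay r) (nact r) (nund r) (ncol r) (nins r) (ngood r) (nstar r) b
       (nball r) (nwts r).
Definition set_wts s r :=
  Node (nid r) (nwt r) (nlay r) (nact r) (nund r) (ncol r) (nins r) (ngood r) (nstar r) (nflag r)
       (nball r) s.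

(** Overlong lists are dropped entirely. They arise only near nodes of high degree, and no good node
    relies on them. *)
Definition cut (T : Type) (l : nat) (s : seq T) : seq T := if (size s <= l)%N then s else [::].

Definition low (D : nat) : step := fun r ns => set_good (size ns <= D)%N r.

Definition shrink : step := fun r ns => set_good (ngood r && all ngood ns) r.

Definition list_ids (l : nat) : step := fun r ns => set_col (ncol r) (cut l [seq nid x | x <- ns]) r.

Definition detect_star : step := fun r ns =>
  set_star (~~ has (fun x => has (fun i => i \in [seq nid y | y <- ns]) (nball x)) ns) r.

Definition seed : step := fun r _ => set_col (nid r) [:: nid r] r.

Definition gather (l : nat) : step := fun r ns =>
  set_col (ncol r) (cut l (nball r ++ flatten [seq nball x | x <- ns])) r.

Definition linial (h : nat -> nat -> nat -> nat) (m : nat) : step := fun r _ =>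
  let al := first_below (fun al =>
     all (fun c => (c != ncol r) ==> (h m al c != h m al (ncol r))) (nball r)) (2 ^ m) in
  let c := (al * 2 ^ m + h m al (ncol r))%N in set_col c [:: c] r.

Definition own (r : node) : rat := if nins r then nwt r else 0.

Definition propose_single (theta : rat) (k : nat) : step := fun r ns =>
  set_flag [&& ngood r, ncol r == k &
              theta * (own r + \sum_(x <- ns) own x) < nwt r] r.

Definition list_weights (l : nat) : step := fun r ns =>
  set_wts (cut l (own r :: map own ns)) r.

Definition propose_star (theta : rat) (k : nat) : step := fun r ns =>
  set_flag [&& ngood r, nstar r, ncol r == k &
              theta * (own r + \sum_(x <- ns) (\sum_(q <- nwts x) q - own r)) <
              \sum_(x <- ns) nwt x] r.

(** The flag is overwritten, not accumulated: a star move inserts the neighbors of its center and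
    not the center. *)
Definition forward_flag : step := fun r ns => set_flag (has nflag ns) r.

Definition insert_flagged : step := fun r ns =>
  set_ins (nflag r || (nins r && ~~ has nflag ns)) r.

Definition preparation D l : seq step := [:: low D; shrink; shrink; list_ids l; detect_star].

Definition coloring h l s d : seq step :=
  seed :: countdown (fun m => [:: gather l; gather l; gather l; linial h m]) s d.

Definition program_turn theta l (t : bool * nat) : seq step :=
  if t.1 then [:: list_weights l; propose_star theta t.2; forward_flag; insert_flagged]
  else [:: propose_single theta t.2; insert_flagged].

Definition turn_list K : seq (bool * nat) :=
  [seq (false, k) | k <- iota 0 K] ++ [seq (true, k) | k <- iota 0 K].

Definition program_sweep theta l K : seq step :=
  flatten [seq program_turn theta l t | t <- turn_list K].

Definition phase2 h theta D l s d L : seq step :=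
  preparation D l ++ coloring h l s d ++
  flatten [seq program_sweep theta l (2 ^ (3 * s)) | _ <- iota 0 L].

Section PhaseTwo.
Variables (V : finType) (e : rel V) (w : V -> rat) (id : V -> nat) (ports : V -> seq V).
Hypotheses (eS : symmetric e) (eI : irreflexive e) (w0 : forall v, 0 <= w v).
Hypotheses (hp : port_numbering e ports) (id_inj : injective id).

Lemma neighbor_all (cfg : V -> node) v (P : pred node) :
  all P [seq cfg u | u <- ports v] = [forall u, e v u ==> P (cfg u)].
Proof.
rewrite all_map; apply/allP/forallP => [h u|h u].
  by apply/implyP => vu; apply: h; rewrite (perm_mem (hp v)) mem_enum inE.
by rewrite (perm_mem (hp v)) mem_enum inE => vu; have /implyP/(_ vu) := h u.
Qed.

Lemma neighbor_map (T : eqType) (cfg : V -> node) v (F : node -> T) x :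
  (x \in [seq F y | y <- [seq cfg u | u <- ports v]]) = [exists u, e v u && (x == F (cfg u))].
Proof.
rewrite -map_comp; apply/mapP/existsP => -[u].
  by rewrite (perm_mem (hp v)) mem_enum inE => vu /= ->; exists u; rewrite vu eqxx.
move=> /andP[vu /eqP ->]; exists u => //.
by rewrite (perm_mem (hp v)) mem_enum inE.
Qed.

Section Low.
Variables (D l : nat).
Hypothesis Dl : ((D.+1) ^ 3 <= l)%N.

Lemma degree_cut : (D.+1 <= l)%N.
Proof. by apply: leq_trans Dl; rewrite -{1}[D.+1]expn1 leq_pexp2l. Qed.

Definition low_node v : bool := (#|neighbors e v| <= D)%N.
Definition good1 v : bool := low_node v && [forall u, e v u ==> low_node u].
(** Low degrees up to distance two ensure that three rounds of gathering collect at most $(D+1)^3$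
    colors. *)
Definition good2 v : bool := good1 v && [forall u, e v u ==> good1 u].

Lemma good_walk v x : good2 v -> e v x ->
  [/\ low_node v, low_node x & forall y, e x y -> low_node y].
Proof.
case/andP => /andP[lv _] /forallP/(_ x)/implyP g vx.
have /andP[lx /forallP ly] := g vx; split=> // y xy.
by have /implyP := ly y; apply.
Qed.

Lemma prepared cfg (cfg' := run ports (preparation D l) cfg) :
    (forall v, nid (cfg v) = id v) ->
  [/\ forall v, nid (cfg' v) = id v, forall v, nwt (cfg' v) = nwt (cfg v),
      forall v, nins (cfg' v) = nins (cfg v), forall v, ngood (cfg' v) = good2 v
    & forall v, good2 v -> nstar (cfg' v) = independent e (neighbors e v)].
Proof.
move=> idE; rewrite /cfg' {cfg'} /preparation /run [foldl _ _ _]/=.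
move E1: (round ports (low D) cfg) => cfg1.
move E2: (round ports shrink cfg1) => cfg2.
move E3: (round ports shrink cfg2) => cfg3.
move E4: (round ports (list_ids l) cfg3) => cfg4.
have g1 v : ngood (cfg1 v) = low_node v.
  by rewrite -E1 /round /= size_map (neighbor_size hp).
have g2 v : ngood (cfg2 v) = good1 v.
  rewrite -E2 /round /= neighbor_all g1; congr (_ && _).
  by apply: eq_forallb => u; rewrite g1.
have g3 v : ngood (cfg3 v) = good2 v.
  rewrite -E3 /round /= neighbor_all g2; congr (_ && _).
  by apply: eq_forallb => u; rewrite g2.
have idE3 v : nid (cfg3 v) = id v by rewrite -E3 -E2 -E1 -idE.
have idE4 v : nid (cfg4 v) = id v by rewrite -E4 -idE3.
split.
- exact: idE4.
- by move=> v; rewrite -E4 -E3 -E2 -E1.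
- by move=> v; rewrite -E4 -E3 -E2 -E1.
- by move=> v; rewrite -g3 -E4.
move=> v gv; rewrite /round /= (neighbor_has hp) /independent.
have ballE u : e v u -> nball (cfg4 u) = [seq nid x | x <- [seq cfg3 y | y <- ports u]].
  move=> vu; have [_ lu _] := good_walk gv vu.
  rewrite -E4 /round /= /cut !size_map (neighbor_size hp) ifT //.
  apply: leq_trans lu _; apply: leq_trans (leqnSn D) _; exact: degree_cut.
have mem_ids i : (i \in [seq nid y | y <- [seq cfg4 u | u <- ports v]]) = [exists u, e v u && (i == id u)].
  by rewrite neighbor_map; apply: eq_existsb => u; rewrite idE4.
apply/idP/idP.
  move=> /existsPn no; apply/forall_inP => x; rewrite inE => vx.
  apply/forall_inP => y; rewrite inE => vy; apply/negP => xy.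
  have := no x; rewrite vx /= ballE // => /hasPn/(_ (id y)).
  rewrite mem_ids neighbor_map => /(_ _)/negP; apply.
    by apply/existsP; exists y; rewrite xy idE3 eqxx.
  by apply/existsP; exists y; rewrite vy eqxx.
move=> /forall_inP ind; apply/existsPn => x; apply/negP => /andP[vx].
rewrite ballE // => /hasP[i]; rewrite mem_ids neighbor_map.
move=> /existsP[y /andP[xy /eqP ->]] /existsP[z /andP[vz]]; rewrite idE3 => /eqP/id_inj yz.
have xN : x \in neighbors e v by rewrite inE.
rewrite yz in xy.
by have /forall_inP/(_ z) := ind x xN; rewrite inE vz xy => /(_ isT).
Qed.

(** * Coloring that separates good nodes up to distance three *)

Section Coloring.
Variables (h : nat -> nat -> nat -> nat) (s : nat).
Hypotheses (hash_h : hash_family h) (s2 : (1 < s)%N) (ls : (2 * l < 2 ^ s)%N).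

(** Walks of length two or three, the range in which two stars may share a leaf or have adjacent
    leaves. Adjacent nodes are included by walking back and forth. *)
Definition near v v' : bool :=
  [exists x, e v x && (e x v' || [exists y, e x y && e y v'])].

Definition same_data (cfg cfg' : V -> node) : Prop :=
  forall v, [/\ nid (cfg' v) = nid (cfg v), nwt (cfg' v) = nwt (cfg v),
    nins (cfg' v) = nins (cfg v), ngood (cfg' v) = ngood (cfg v)
    & nstar (cfg' v) = nstar (cfg v)].

Lemma same_data_trans c1 c2 c3 : same_data c1 c2 -> same_data c2 c3 -> same_data c1 c3.
Proof.
by move=> h1 h2 v; have [? ? ? ? ?] := h1 v; have [-> -> -> -> ->] := h2 v.
Qed.

(** After the $i$-th round the lists that matter have length at most $(D+1)^i$, so [cut] leaves them
    intact. *)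
Lemma gathered m cfg (cfg' := run ports [:: gather l; gather l; gather l] cfg) :
    (forall v, nball (cfg v) = [:: ncol (cfg v)]) ->
    (forall v, ncol (cfg v) < 2 ^ m)%N ->
  [/\ same_data cfg cfg', forall v, ncol (cfg' v) = ncol (cfg v),
      forall v, (size (nball (cfg' v)) <= l)%N,
      forall v, all (fun c => (c < 2 ^ m)%N) (nball (cfg' v))
    & forall v v', good2 v -> near v v' -> ncol (cfg v') \in nball (cfg' v)].
Proof.
move=> b0 c0; rewrite /cfg' {cfg'} /run [foldl _ _ _]/=.
move E1: (round ports (gather l) cfg) => cfg1.
move E2: (round ports (gather l) cfg1) => cfg2.
have cut_size T (x : seq T) : (size (cut l x) <= l)%N by rewrite /cut; case: ifP.
have cut_all (P : pred nat) x : all P x -> all P (cut l x) by rewrite /cut; case: ifP.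
have flat_all (P : pred nat) (c : V -> node) v : (forall u, all P (nball (c u))) ->
    all P (flatten [seq nball x | x <- [seq c u | u <- ports v]]).
  by move=> hP; elim: (ports v) => //= x s' IH; rewrite all_cat hP.
have flat_mem (c : V -> node) v u i : e v u -> i \in nball (c u) ->
    i \in flatten [seq nball x | x <- [seq c u | u <- ports v]].
  move=> vu ic; apply/flattenP; exists (nball (c u)) => //; rewrite -map_comp.
  by apply/mapP; exists u; rewrite ?(perm_mem (hp v)) ?mem_enum ?inE.
have flat_size (c : V -> node) v k : low_node v ->
    (forall u, e v u -> (size (nball (c u)) <= k)%N) ->
    (size (flatten [seq nball x | x <- [seq c u | u <- ports v]]) <= D * k)%N.
  rewrite /low_node -(neighbor_size hp) => lv hk.
  apply: (@leq_trans (size (ports v) * k)); last by rewrite leq_mul2r lv orbT.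
  have {}hk u : u \in ports v -> (size (nball (c u)) <= k)%N.
    by rewrite (perm_mem (hp v)) mem_enum inE; apply: hk.
  elim: (ports v) hk => //= x s' IH hk; rewrite size_cat mulSn leq_add ?hk ?inE ?eqxx //.
  by apply: IH => u us; rewrite hk // inE us orbT.
have col1 v : ncol (cfg1 v) = ncol (cfg v) by rewrite -E1.
have col2 v : ncol (cfg2 v) = ncol (cfg v) by rewrite -E2 -col1.
have all0 v : all (fun c => (c < 2 ^ m)%N) (nball (cfg v)) by rewrite b0 /= c0.
have all1 v : all (fun c => (c < 2 ^ m)%N) (nball (cfg1 v)).
  by rewrite -E1 /round /=; apply: cut_all; rewrite all_cat all0 flat_all.
have all2 v : all (fun c => (c < 2 ^ m)%N) (nball (cfg2 v)).
  by rewrite -E2 /round /=; apply: cut_all; rewrite all_cat all1 flat_all.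
have pw i : (0 < i)%N -> (i <= 3)%N -> (D.+1 ^ i <= l)%N.
  by move=> i0 i3; apply: leq_trans Dl; rewrite leq_pexp2l.
have ball1 v : low_node v -> nball (cfg1 v) = (nball (cfg v) ++
    flatten [seq nball x | x <- [seq cfg u | u <- ports v]])%SEQ /\
    (size (nball (cfg1 v)) <= D.+1 ^ 1)%N.
  move=> lv; have sz : (size (nball (cfg v) ++
      flatten [seq nball x | x <- [seq cfg u | u <- ports v]])%SEQ <= D.+1 ^ 1)%N.
    rewrite size_cat b0 expn1 addSn add0n ltnS -[D]muln1; apply: flat_size => // u _.
    by rewrite b0.
  by rewrite -E1 /round /= /cut ifT // (leq_trans sz) // pw.
have ball2 v : low_node v -> (forall u, e v u -> low_node u) ->
    nball (cfg2 v) = (nball (cfg1 v) ++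
    flatten [seq nball x | x <- [seq cfg1 u | u <- ports v]])%SEQ /\
    (size (nball (cfg2 v)) <= D.+1 ^ 2)%N.
  move=> lv lu; have sz : (size (nball (cfg1 v) ++
      flatten [seq nball x | x <- [seq cfg1 u | u <- ports v]])%SEQ <= D.+1 ^ 2)%N.
    rewrite size_cat (_ : D.+1 ^ 2 = D.+1 ^ 1 + D * D.+1 ^ 1)%N; last by rewrite -mulSn.
    by apply: leq_add; [have [] := ball1 v lv|apply: flat_size => // u /lu/ball1[]].
  by rewrite -E2 /round /= /cut ifT // (leq_trans sz) // pw.
split.
- by move=> v; rewrite -E2 -E1.
- by move=> v; rewrite -col2.
- by move=> v; rewrite /round /= cut_size.
- by move=> v; rewrite /round /=; apply: cut_all; rewrite all_cat all2 flat_all.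
move=> v v' gv /existsP[x /andP[vx near_x]].
have [lv lx ly] := good_walk gv vx.
have ball2x := ball2 x lx ly.
have sz : (size (nball (cfg2 v) ++
      flatten [seq nball x | x <- [seq cfg2 u | u <- ports v]])%SEQ <= D.+1 ^ 3)%N.
  rewrite size_cat (_ : D.+1 ^ 3 = D.+1 ^ 2 + D * D.+1 ^ 2)%N; last by rewrite -mulSn.
  apply: leq_add; first by have [] := ball2 v lv (fun u vu => let: And3 _ lu _ := good_walk gv vu in lu).
  apply: flat_size => // u vu; have [_ lu lz] := good_walk gv vu.
  by have [] := ball2 u lu lz.
rewrite /round /= /cut ifT ?(leq_trans sz) ?pw // mem_cat; apply/orP; right.
apply: (flat_mem _ _ _ _ vx); have [-> _] := ball2x; rewrite mem_cat.
case/orP: near_x => [xv'|/existsP[y /andP[xy yv']]].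
  apply/orP; left; have [-> _] := ball1 x lx; rewrite mem_cat; apply/orP; right.
  by apply: flat_mem xv' _; rewrite b0 inE.
apply/orP; right; apply: (flat_mem _ _ _ _ xy).
have [-> _] := ball1 y (ly y xy); rewrite mem_cat; apply/orP; right.
by apply: flat_mem yv' _; rewrite b0 inE.
Qed.

Definition proper3 (cfg : V -> node) : Prop :=
  forall v v', good2 v -> good2 v' -> v <> v' -> near v v' -> ncol (cfg v) <> ncol (cfg v').

(** Each of at most [l] foreign colors spoils at most two points, and $2l<2^s\le2^m$ leaves a point
    free of all collisions. Since equal new colors force equal points, the choice of one endpoint
    already separates the pair. *)
Lemma linial_loop d cfg :
    (forall v, nball (cfg v) = [:: ncol (cfg v)]) ->
    (forall v, ncol (cfg v) < 2 ^ (3 * (s + d)))%N -> proper3 cfg ->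
  let cfg' := run ports
    (countdown (fun m => [:: gather l; gather l; gather l; linial h m]) s d) cfg in
  [/\ same_data cfg cfg', forall v, (ncol (cfg' v) < 2 ^ (3 * s))%N & proper3 cfg'].
Proof.
elim: d cfg => [|d IH] cfg b0 c0 pr; first by rewrite addn0 in c0.
rewrite [countdown _ _ _]/= -[[:: _, _, _, _ & _]]/([:: gather l; gather l; gather l] ++ _ :: _).
rewrite run_cat; set m := (s + d.+1)%N in c0 *.
have [sd1 col1 size1 all1 near1] := gathered b0 c0.
set cfg1 := run _ _ cfg in sd1 col1 size1 all1 near1 *.
clearbody cfg1; rewrite /run [foldl _ _ _]/= -/(run _ _ _).
have m0 : (0 < m)%N by rewrite /m addnS.
move E2: (round ports (linial h m) cfg1) => cfg2.
have q0 : (0 < 2 ^ m)%N by rewrite expn_gt0.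
pose ok v al := all (fun c => (c != ncol (cfg v)) ==> (h m al c != h m al (ncol (cfg v))))
  (nball (cfg1 v)).
pose al v := first_below (ok v) (2 ^ m).
have col2 v : ncol (cfg2 v) = recolor h m (ncol \o cfg) v (al v).
  by rewrite -E2 /round /linial /= col1.
have ball2 v : nball (cfg2 v) = [:: ncol (cfg2 v)] by rewrite -E2.
have sd2 : same_data cfg cfg2.
  by move=> v; have := sd1 v; rewrite -E2.
have c2 v : (ncol (cfg2 v) < 2 ^ (3 * (s + d)))%N.
  rewrite col2; apply: leq_trans (recolor_lt hash_h m0 _ _ (first_below_lt _ q0)) _.
  by rewrite leq_exp2l // /m; lia.
have alP v : ok v (al v).
  apply: first_belowP; apply: contrapT => no.
  have cnt : (2 ^ m <= \sum_(c <- nball (cfg1 v) | c != ncol (cfg v))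
      count (fun al => h m al c == h m al (ncol (cfg v))) (iota 0 (2 ^ m)))%N.
    rewrite -[leqLHS](size_iota 0) -sum1_size.
    under [leqRHS]eq_bigr => c _ do rewrite -sum1_count big_mkcond.
    rewrite exchange_big /= [leqLHS]big_seq [leqRHS]big_seq; apply: leq_sum => be; rewrite mem_iota add0n => /= beq.
    have /allPn[c cb] : ~~ ok v be by apply/negP => okb; apply: no; exists be.
    rewrite negb_imply negbK => /andP[cn ceq].
    by rewrite big_mkcond (big_rem c) //= cn ceq; apply: leq_addr.
  have : (\sum_(c <- nball (cfg1 v) | c != ncol (cfg v))
      count (fun al => h m al c == h m al (ncol (cfg v))) (iota 0 (2 ^ m)) <= 2 * l)%N.
    apply: (@leq_trans (\sum_(c <- nball (cfg1 v)) 2)); last first.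
      by rewrite big_const_seq count_predT iter_addn_0 leq_mul2l size1.
    rewrite big_mkcond big_seq [leqRHS]big_seq; apply: leq_sum => c cb; case: ifP => // cn.
    by apply: ((hash_h m0).2 _ _ _ _ cn); [have /allP := all1 v; apply|apply: c0].
  have : (2 ^ s <= 2 ^ m)%N by rewrite leq_exp2l // leq_addr.
  lia.
have pr2 : proper3 cfg2.
  move=> v v' gv gv' vv' nr; rewrite !col2 => /(recolor_inj hash_h m0)[e1 e2].
  have /allP/(_ _ (near1 v v' gv nr)) := alP v; rewrite e1 -e2 -e1 eqxx implybF negbK.
  by move/eqP => cc; apply: (pr v v').
have [sd3 c3 pr3] := IH cfg2 ball2 c2 pr2.
by split => //; apply: same_data_trans sd3.
Qed.

Lemma colored d cfg (cfg' := run ports (coloring h l s d) cfg) :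
    (forall v, nid (cfg v) = id v) -> (forall v, id v < 2 ^ (3 * (s + d)))%N ->
  [/\ same_data cfg cfg', forall v, (ncol (cfg' v) < 2 ^ (3 * s))%N & proper3 cfg'].
Proof.
move=> idE idl; rewrite /cfg' {cfg'} /coloring /run [foldl _ _ _]/= -/(run _ _ _).
move E1: (round ports seed cfg) => cfg1.
have [|||sd c pr] := linial_loop (d := d) (cfg := cfg1).
- by move=> v; rewrite -E1.
- by move=> v; rewrite -E1 /= idE.
- by move=> v v' _ _ vv' _; rewrite -E1 /= !idE => /id_inj.
- split => //; apply: same_data_trans sd; by move=> v; rewrite -E1.
Qed.

End Coloring.
End Low.
End PhaseTwo.

(** * Sweeps of local moves *)

Section Sweeps.
Variables (V : finType) (e : rel V) (w : V -> rat) (id : V -> nat) (ports : V -> seq V).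
Hypotheses (eS : symmetric e) (eI : irreflexive e) (w0 : forall v, 0 <= w v).
Hypothesis hp : port_numbering e ports.
Variables (D l : nat) (theta : rat).
Hypotheses (Dl : ((D.+1) ^ 3 <= l)%N) (theta1 : 1 < theta).
Variables (K : nat) (col : V -> nat) (star : V -> bool).
Hypothesis starE : forall v, good2 e D v -> star v = independent e (neighbors e v).
Hypothesis col_proper : forall v v', good2 e D v -> good2 e D v' -> v <> v' ->
  near e v v' -> col v <> col v'.

Definition ready (cfg : V -> node) : Prop :=
  forall v, [/\ nid (cfg v) = id v, nwt (cfg v) = w v, ncol (cfg v) = col v,
    ngood (cfg v) = good2 e D v & nstar (cfg v) = star v].

Definition inset (cfg : V -> node) : {set V} := [set v | nins (cfg v)].

Definition color_class (b : bool) (k : nat) : {set V} :=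
  [set v | [&& good2 e D v, b ==> star v & col v == k]].

Lemma color_class_spread b k : spread e b (color_class b k).
Proof.
have far v v' : v \in color_class b k -> v' \in color_class b k -> near e v v' -> v = v'.
  rewrite !inE => /and3P[gv _ /eqP cv] /and3P[gv' _ /eqP cv'] nr.
  by apply: contrapT => vv'; apply: (col_proper gv gv' vv' nr); rewrite cv cv'.
move=> v v' x x' vC v'C; case: b vC v'C far => vC v'C far; rewrite /= !inE.
- move=> vx v'x'; split; last first.
    move=> xx'; apply: far => //; apply/existsP; exists x; rewrite vx /=.
    by rewrite xx' eS v'x'.
  apply/negP => xx'; have vv' : v = v'.
    apply: far => //; apply/existsP; exists x; rewrite vx /=.
    by apply/orP; right; apply/existsP; exists x'; rewrite xx' eS v'x'.
  move: vC; rewrite inE => /and3P[gv /= sv _]; rewrite starE // in sv.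
  have /forall_inP/(_ x) := sv; rewrite inE vx => /(_ isT)/forall_inP/(_ x').
  by rewrite inE vv' v'x' xx' => /(_ isT).
- move=> /eqP -> /eqP ->; split => //; apply/negP => vv'.
  have eq : v = v'.
    apply: far => //; apply/existsP; exists v'; rewrite vv' /=.
    by apply/orP; right; apply/existsP; exists v; rewrite eS vv'.
  by rewrite eq eI in vv'.
Qed.

Lemma cost_single sg v : cost e false sg v = sg v + \sum_(x | e v x) sg x.
Proof.
rewrite /cost /=; under eq_bigr => x _ do rewrite natrD mulrDr.
rewrite big_split /=; congr (_ + _).
  by rewrite (bigD1 v) //= eqxx mulr1 big1 ?addr0 // => x /negbTE ->; rewrite mulr0.
by rewrite [RHS]big_mkcond; apply: eq_bigr => x _; case: (e v x); rewrite ?mulr1 ?mulr0.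
Qed.

Lemma cost_star sg v : cost e true sg v =
  sg v + \sum_(u | e v u) (sg u + \sum_(x | e u x) sg x - sg v).
Proof.
rewrite /cost /=; under eq_bigr => x _ do rewrite natrD mulrDr natr_sum mulr_sumr.
rewrite big_split /= exchange_big /=; congr (_ + _).
  by rewrite (bigD1 v) //= eqxx mulr1 big1 ?addr0 // => x /negbTE ->; rewrite mulr0.
apply: eq_bigr => u vu; under eq_bigr => x _ do rewrite natrD mulrDr.
rewrite big_split /= -addrA; congr (_ + _).
  by rewrite (bigD1 u) //= eqxx mulr1 big1 ?addr0 // => x /negbTE ->; rewrite mulr0.
rewrite [X in _ = X - _](bigD1 v) /= ?[e u v]eS // addrAC subrr add0r.
rewrite (bigD1 v) //= eqxx andbF mulr0 add0r.
rewrite [LHS]big_mkcond [RHS]big_mkcond; apply: eq_bigr => x _.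
by case: (e u x) (x == v) => [] [] //=; rewrite ?mulr1 ?mulr0.
Qed.

Lemma ownE cfg v : ready cfg -> own (cfg v) = on w (inset cfg) v.
Proof. by move=> rc; rewrite /own /on inE; have [_ -> _ _ _] := rc v. Qed.

Lemma insert_turn b k cfg cfg1 : ready cfg1 -> inset cfg1 = inset cfg ->
    (forall v, nflag (cfg1 v) = (v \in insertions e w theta b (color_class b k) (inset cfg))) ->
  ready (round ports insert_flagged cfg1) /\
  inset (round ports insert_flagged cfg1) = turn e w theta b (color_class b k) (inset cfg).
Proof.
move=> r1 S1 fl; split=> [v|]; first exact: (r1 v).
have S1E v : nins (cfg1 v) = (v \in inset cfg) by rewrite -S1 inE.
apply/setP => v; rewrite [LHS]in_set [RHS]in_set /round /= (neighbor_has hp) S1E fl.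
congr (_ || (_ && ~~ _)).
by apply: eq_existsb => u; rewrite fl andbC.
Qed.

Lemma run_turn t cfg (cfg' := run ports (program_turn theta l t) cfg) : ready cfg ->
  ready cfg' /\ inset cfg' = turn e w theta t.1 (color_class t.1 t.2) (inset cfg).
Proof.
case: t => -[] k in cfg' * => rc; rewrite /cfg' {cfg'} /program_turn /run [foldl _ _ _]/=.
- move E1: (round ports (list_weights l) cfg) => cfg1.
  move E2: (round ports (propose_star theta k) cfg1) => cfg2.
  have r2 : ready cfg2 by rewrite /ready => v; rewrite -E2 -E1; apply: (rc v).
  have S1 v : nins (cfg1 v) = (v \in inset cfg) by rewrite -E1 inE.
  have r1 : ready cfg1 by rewrite /ready => v; rewrite -E1; apply: (rc v).
  have own1 v : own (cfg1 v) = on w (inset cfg) v.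
    by rewrite /own /on S1; have [_ -> _ _ _] := r1 v.
  have fl2 v : nflag (cfg2 v) = (v \in fired e w theta true (color_class true k) (inset cfg)).
    rewrite -E2 /round /= !inE; have [_ _ -> -> ->] := r1 v.
    case gv: (good2 e D v) => //=; rewrite -andbA; congr (_ && (_ && (_ < _))); last first.
      rewrite (neighbor_sum hp _ _ predT) /weight; apply: eq_big => [u|u _]; first by rewrite andbT inE.
      by have [] := r1 u.
    congr (_ * _); rewrite own1 cost_star (neighbor_sum hp _ _ predT); congr (_ + _).
    apply: eq_big => [u|u]; rewrite andbT // => vu; congr (_ - _).
    have [_ lu _] := good_walk gv vu.
    have -> : nwts (cfg1 u) = own (cfg u) :: map own [seq cfg x | x <- ports u].
      rewrite -E1 /round /= /cut /= !size_map (neighbor_size hp) ifT //.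
      by rewrite (leq_trans _ (degree_cut Dl)).
    rewrite big_cons ownE // big_map (neighbor_sum hp _ _ predT); congr (_ + _).
    by apply: eq_big => [x|x _]; rewrite ?andbT // ownE.
  apply: insert_turn => [||v].
  - by move=> v; apply: (r2 v).
  - by apply/setP => v; rewrite !inE -E2 -E1.
  rewrite /round /= (neighbor_has hp) in_set; apply: eq_existsb => u.
  by rewrite fl2 andbC; congr (_ && _); rewrite /inserted [RHS]inE eS.
- move E1: (round ports (propose_single theta k) cfg) => cfg1.
  have r1 : ready cfg1 by rewrite /ready => v; rewrite -E1; apply: (rc v).
  have fl1 v : nflag (cfg1 v) = (v \in fired e w theta false (color_class false k) (inset cfg)).
    rewrite -E1 /round /= !inE; have [_ -> -> -> _] := rc v.
    case: (good2 e D v) => //=; congr (_ && (_ < _)); last by rewrite /weight big_set1.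
    congr (_ * _); rewrite ownE // cost_single (neighbor_sum hp _ _ predT); congr (_ + _).
    by apply: eq_big => [x|x _]; rewrite ?andbT // ownE.
  apply: insert_turn => // [|v]; first by apply/setP => v; rewrite !inE -E1.
  rewrite fl1 [RHS]in_set; apply/idP/exists_inP => [vF|[u uF]]; first by exists v; rewrite ?set11.
  by rewrite inE => /eqP ->.
Qed.

Definition turns : local_turns V := [seq (t.1, color_class t.1 t.2) | t <- turn_list K].

Lemma turns_spread t : t \in turns -> spread e t.1 t.2.
Proof. by case/mapP => t' _ ->; apply: color_class_spread. Qed.

Lemma run_sweep cfg (cfg' := run ports (program_sweep theta l K) cfg) : ready cfg ->
  ready cfg' /\ inset cfg' = sweep e w theta turns (inset cfg).
Proof.
rewrite /cfg' /program_sweep /turns {cfg'}; elim: (turn_list K) cfg => //= t ts IH cfg rc.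
rewrite run_cat; have [r1 S1] := run_turn t rc.
by have [r2 S2] := IH _ r1; rewrite S2 S1.
Qed.

Section Improvement.
Variables (M : nat) (O : {set V}).
Hypotheses (M1 : (1 < M)%N) (MD : (M <= D)%N) (degM : forall v, (#|neighbors e v| <= M)%N).
Hypotheses (K0 : (0 < K)%N) (colK : forall v, (col v < K)%N) (iO : independent e O).

Let all_good v : good2 e D v.
Proof.
have lowv u : low_node e D u by apply: leq_trans (degM u) MD.
have g1 u : good1 e D u by rewrite /good1 lowv; apply/forallP => x; rewrite lowv implybT.
by rewrite /good2 g1; apply/forallP => x; rewrite g1 implybT.
Qed.

(** [M] bounds the actual degrees and is unknown to the nodes; [D] is the threshold built into the
    program. As [M <= D] makes every node good, the turns cover all centers. *)
Lemma sweep_optimum (S : {set V}) : exists ad : rat, [/\ 0 <= ad,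
    ad * (1 - theta^-1) <= weight w (sweep e w theta turns S) - weight w S
  & weight w O <= theta * (M%:R * (weight w S + ad) - weight w S / K%:R)].
Proof.
have [ad [ad0 gain claims]] := sweep_claims eS w0 theta1 S turns_spread.
exists (\sum_x ad x); split => //; first exact: sumr_ge0.
have in_turns b v : v \in color_class b (col v) -> weight w (inserted e b v) <=
    theta * cost e b (fun x => on w S x + ad x) v.
  move=> vC; apply: (claims (b, color_class b (col v))) => //.
  apply/mapP; exists (b, col v) => //; rewrite mem_cat.
  by case: b vC => _; apply/orP; [right|left]; rewrite map_f // mem_iota /= colK.
have -> : weight w S + \sum_x ad x = \sum_x (on w S x + ad x).
  by rewrite big_split /= sum_on.
apply: (local_optimum eS w0 theta1 M1 degM K0 colK) => //.
- move=> v v' u cvv' vu v'u; apply: contrapT => vv'.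
  apply: (col_proper (all_good v) (all_good v') vv' _ cvv').
  by apply/existsP; exists u; rewrite vu eS v'u.
- by move=> x; rewrite addr_ge0 ?on_ge0.
- by move=> x xS; rewrite /on xS lerDl.
- move=> v; have := in_turns false v; rewrite /weight big_set1; apply.
  by rewrite inE all_good /= eqxx.
- move=> v iv; apply: (in_turns true v).
  by rewrite inE all_good /= starE // iv eqxx.
Qed.

(** If the sweep gains less than $z^2/2$ times the weight, then [ad] is at most $z$ times the
    weight, because $1-\theta^{-1}=z/(1+z)$ and $z\le1$. The remaining error is at most $3Mz\le
    3/(8K)$, which leaves more than half of the saving $1/K$. *)
Lemma sweep_progress (z : rat) (S : {set V}) : 0 < z -> theta = 1 + z ->
    8%:R * K%:R * D%:R * z <= 1 ->
  weight w O <= (M%:R - (2%:R * K%:R)^-1) * weight w S \/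
  (1 + z ^+ 2 / 2%:R) * weight w S <= weight w (sweep e w theta turns S).
Proof.
move=> z0 thE zs; have [ad [ad0 gain opt]] := sweep_optimum S.
case: (leP ((1 + z ^+ 2 / 2%:R) * weight w S) (weight w (sweep e w theta turns S))) => [|small]; first by right.
left; apply: le_trans opt _.
have S0 : 0 <= weight w S by apply: sumr_ge0.
have K1 : 1 <= K%:R :> rat by rewrite ler1n.
have D1 : 1 <= D%:R :> rat by rewrite ler1n (leq_trans _ MD) // ltnW.
have M0 : 0 <= M%:R :> rat by [].
have MD' : M%:R <= D%:R :> rat by rewrite ler_nat.
have z1 : z <= 1.
  apply: le_trans zs; rewrite ler_peMl ?(ltW z0) // -!natrM ler1n !muln_gt0 K0 /=.
  by rewrite (leq_trans _ MD) // ltnW.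
have thinv : theta^-1 * theta = 1 by rewrite mulVf // gt_eqF // (lt_trans _ theta1).
have adle : ad <= z * weight w S.
  have gain' : ad * z <= z ^+ 2 / 2%:R * weight w S * theta.
    have : ad * (1 - theta^-1) <= z ^+ 2 / 2%:R * weight w S.
      by apply: le_trans gain _; move: small; lra.
    have th0 : 0 <= theta by rewrite ltW // (lt_trans _ theta1).
    move/(ler_wpM2r th0); have -> : ad * (1 - theta^-1) * theta = ad * z.
      by rewrite -mulrA mulrBl thinv mul1r thE addrAC subrr add0r.
    by [].
  rewrite -(ler_pM2r z0); apply: le_trans gain' _.
  have -> : z * weight w S * z = z ^+ 2 / 2%:R * weight w S * 2%:R by field.
  apply: ler_wpM2l; first by rewrite mulr_ge0 ?divr_ge0 ?sqr_ge0.
  by rewrite thE; lra.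
have -> : (2%:R * K%:R)^-1 = (K%:R)^-1 / 2%:R :> rat by rewrite invfM mulrC.
set q := (K%:R)^-1; have q0 : 0 < q by rewrite invr_gt0 (lt_le_trans _ K1).
have qz : 8%:R * D%:R * z <= q.
  rewrite -[q]mul1r -ler_pdivrMr // /q invrK; move: zs; lra.
have step : M%:R * (weight w S + ad) <= M%:R * (1 + z) * weight w S.
  by rewrite -mulrA ler_wpM2l // mulrDl mul1r lerD2l.
apply: (@le_trans _ _ (theta * ((M%:R * (1 + z) - q) * weight w S))).
  rewrite ler_wpM2l //; first by rewrite ltW // (lt_trans _ theta1).
  by rewrite mulrBl [q * _]mulrC lerD2r.
rewrite mulrA ler_wpM2r // thE.
have Mz : M%:R * z <= q / 8%:R.
  by have := ler_wpM2r (ltW z0) MD'; move: qz; lra.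
have Mz0 : 0 <= M%:R * z by rewrite mulr_ge0 // ltW.
have Mzz : M%:R * z * z <= M%:R * z by rewrite ler_piMr.
have zq : 0 <= z * q by rewrite mulr_ge0 ?ltW.
have -> : (1 + z) * (M%:R * (1 + z) - q) =
  M%:R + 2%:R * (M%:R * z) + M%:R * z * z - q - z * q by ring.
move: Mz Mzz zq; lra.
Qed.

End Improvement.

(** A ratio certified by one sweep persists since weights never decrease; if no sweep certifies it,
    the gains multiply. *)
Lemma sweeps_correct L cfg (cfg' := run ports
      (flatten [seq program_sweep theta l K | _ <- iota 0 L]) cfg) : ready cfg ->
    independent e (inset cfg) ->
  [/\ ready cfg', independent e (inset cfg'), weight w (inset cfg) <= weight w (inset cfg')
    & forall M O (z : rat), (1 < M)%N -> (M <= D)%N ->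
       (forall v, (#|neighbors e v| <= M)%N) -> (0 < K)%N ->
       (forall v, (col v < K)%N) -> independent e O -> 0 < z -> theta = 1 + z ->
       8%:R * K%:R * D%:R * z <= 1 ->
       weight w O <= (M%:R - (2%:R * K%:R)^-1) * weight w (inset cfg') \/
       (1 + z ^+ 2 / 2%:R) ^+ L * weight w (inset cfg) <= weight w (inset cfg')].
Proof.
rewrite /cfg' {cfg'} => rc ic; elim: L => [|L].
  by split => // *; right; rewrite expr0 mul1r.
rewrite -[in iota 0 L.+1]addn1 iotaD map_cat flatten_cat run_cat add0n.
set cfg1 := run ports (flatten _) cfg => -[r1 i1 le1 alt1].
have -> : flatten [seq program_sweep theta l K | _ <- iota L 1] = program_sweep theta l K.
  by rewrite /= cats0.
have [r2 S2] := run_sweep r1.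
have le2 := sweep_weight eS w0 theta1 (inset cfg1) turns_spread.
split; rewrite ?S2 //.
- by apply: sweep_independent => //; apply: turns_spread.
- exact: le_trans le1 le2.
move=> M O z M1 MD dM K0 cK iO z0 thE zs.
have M0 : 0 <= M%:R - (2%:R * K%:R)^-1 :> rat.
  rewrite subr_ge0; apply: (@le_trans _ _ 1); last by rewrite ler1n ltnW.
  by rewrite invf_le1 ?ltr0n ?muln_gt0 -natrM ?ler1n ?ltr0n muln_gt0.
case: (alt1 M O z) => // [opt|grow].
  by left; apply: le_trans opt _; rewrite ler_wpM2l.
case: (sweep_progress M1 MD dM K0 cK iO (inset cfg1) z0 thE zs) => [opt|grow2].
  by left; apply: le_trans opt _; rewrite ler_wpM2l.
right; apply: le_trans grow2; rewrite exprS -mulrA ler_wpM2l //.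
by rewrite addr_ge0 // divr_ge0 ?sqr_ge0.
Qed.

End Sweeps.

Section PhaseTwoCorrect.
Variables (V : finType) (e : rel V) (w : V -> rat) (id : V -> nat) (ports : V -> seq V).
Hypotheses (eS : symmetric e) (eI : irreflexive e) (w0 : forall v, 0 <= w v).
Hypotheses (hp : port_numbering e ports) (id_inj : injective id).

Lemma phase2_correct h theta D l s d L cfg
    (cfg' := run ports (phase2 h theta D l s d L) cfg) (K := (2 ^ (3 * s))%N) :
    hash_family h -> (1 < s)%N -> (2 * l < 2 ^ s)%N -> (D.+1 ^ 3 <= l)%N -> 1 < theta ->
    (forall v, id v < 2 ^ (3 * (s + d)))%N ->
    (forall v, nid (cfg v) = id v /\ nwt (cfg v) = w v) -> independent e (inset cfg) ->
  [/\ forall v, nid (cfg' v) = id v /\ nwt (cfg' v) = w v,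
      independent e (inset cfg'), weight w (inset cfg) <= weight w (inset cfg')
    & forall M O (z : rat), (1 < M)%N -> (M <= D)%N ->
       (forall v, (#|neighbors e v| <= M)%N) -> independent e O -> 0 < z -> theta = 1 + z ->
       8%:R * K%:R * D%:R * z <= 1 ->
       weight w O <= (M%:R - (2%:R * K%:R)^-1) * weight w (inset cfg') \/
       (1 + z ^+ 2 / 2%:R) ^+ L * weight w (inset cfg) <= weight w (inset cfg')].
Proof.
move=> hh s2 ls Dl th1 idl st ic; rewrite /cfg' {cfg'} /phase2 !run_cat.
have idE v : nid (cfg v) = id v by have [] := st v.
have [id1 w1 ins1 good_1 star1] := prepared hp id_inj Dl idE.
set cfg1 := run _ (preparation _ _) cfg in id1 w1 ins1 good_1 star1 *.
have [sd c2 pr] := colored hp id_inj Dl hh s2 ls id1 idl.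
set cfg2 := run _ (coloring _ _ _ _) cfg1 in sd c2 pr *; clearbody cfg2.
have S2 : inset cfg2 = inset cfg.
  by apply/setP => v; rewrite !inE; have [_ _ -> _ _] := sd v; rewrite ins1.
have starE v : good2 e D v -> nstar (cfg2 v) = independent e (neighbors e v).
  by move=> gv; have [_ _ _ _ ->] := sd v; apply: star1.
have rc : ready e w id D (fun v => ncol (cfg2 v)) (fun v => nstar (cfg2 v)) cfg2.
  move=> v; have [-> -> _ -> _] := sd v; have [_ wv] := st v.
  by split; rewrite // w1.
rewrite -S2 in ic *.
have [r3 i3 le3 alt3] := sweeps_correct eS eI w0 hp Dl th1 K starE pr L rc ic.
split => // [v|M O z *]; first by have [] := r3 v.
by apply: alt3 => //; rewrite expn_gt0.
Qed.

End PhaseTwoCorrect.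

(** * Isolated edges *)

Definition mark_lone : step := fun r ns => set_flag (size ns == 1%N) r.

Definition settle : step := fun r ns =>
  set_ins (if size ns == 0%N then true
           else if (size ns == 1%N) && all nflag ns then
             all (fun x => (nwt x < nwt r) || ((nwt x == nwt r) && (nid x < nid r)%N)) ns
           else nins r) r.

Definition finish : seq step := [:: mark_lone; settle].

Section Finish.
Variables (V : finType) (e : rel V) (w : V -> rat) (id : V -> nat) (ports : V -> seq V).
Hypotheses (eS : symmetric e) (eI : irreflexive e) (w0 : forall v, 0 <= w v).
Hypotheses (hp : port_numbering e ports) (id_inj : injective id).

Definition isolated v : bool :=
  (#|neighbors e v| == 0%N) ||
  ((#|neighbors e v| == 1%N) && [forall u, e v u ==> (#|neighbors e u| == 1%N)]).

Variable cfg : V -> node.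
Hypothesis st : forall v, nid (cfg v) = id v /\ nwt (cfg v) = w v.
Hypothesis ic : independent e (inset cfg).

Let cfg' := run ports finish cfg.

Lemma finish_ins v : nins (cfg' v) =
  if #|neighbors e v| == 0%N then true else
  if isolated v then
    [forall u, e v u ==> ((w u < w v) || (w u == w v) && (id u < id v)%N)]
  else v \in inset cfg.
Proof.
rewrite /cfg' /finish /run [foldl _ _ _]/=.
move E1: (round ports mark_lone cfg) => cfg1.
have fl u : nflag (cfg1 u) = (#|neighbors e u| == 1%N).
  by rewrite -E1 /round /= size_map (neighbor_size hp).
have wE u : nwt (cfg1 u) = w u by rewrite -E1; have [] := st u.
have idE u : nid (cfg1 u) = id u by rewrite -E1; have [] := st u.
rewrite /round /= size_map (neighbor_size hp) !(neighbor_all hp) /isolated.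
case: (#|neighbors e v| == 0%N) => //=.
have -> : [forall u, e v u ==> nflag (cfg1 u)] = [forall u, e v u ==> (#|neighbors e u| == 1%N)].
  by apply: eq_forallb => u; rewrite fl.
case: ifP => _; last by rewrite inE -E1.
by apply: eq_forallb => u; rewrite !wE !idE.
Qed.

Lemma isolated_partner v u : isolated v -> e v u ->
  [/\ isolated u, forall x, e v x = (x == u) & forall x, e u x = (x == v)].
Proof.
move=> iv vu; have vn : (#|neighbors e v| == 0%N) = false.
  by apply/negbTE; rewrite -lt0n; apply/card_gt0P; exists u; rewrite inE.
have one x y : #|neighbors e x| == 1%N -> e x y -> forall z, e x z = (z == y).
  move=> /cards1P[q Nq] xy z.
  have E t : e x t = (t == q).
    have := congr1 (fun A : {set V} => t \in A) Nq; by rewrite !inE.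
  by move: xy; rewrite !E => /eqP ->.
move: iv; rewrite /isolated vn /= => /andP[v1 /forallP u1].
have Nu : #|neighbors e u| == 1%N by have := u1 u; rewrite vu.
have vE := one v u v1 vu; have uE : forall x, e u x = (x == v) by apply: one; rewrite // eS.
split=> //; apply/orP; right; rewrite Nu; apply/forallP => x.
by rewrite uE; apply/implyP => /eqP ->.
Qed.

(** Each node of [I] outside the result is mapped to its partner on an isolated edge, which is at
    least as heavy; independence of [I] makes the map injective. With [I] the previous solution this
    shows that nothing is lost; when all degrees are at most 1 it gives optimality. *)
Lemma finish_correct : independent e (inset cfg') /\
  (forall I, independent e I -> (forall v, v \in I -> ~~ isolated v -> v \in inset cfg) ->
     weight w I <= weight w (inset cfg')).
Proof.
have insE v : (v \in inset cfg') = nins (cfg' v) by rewrite inE.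
have pairE v u : isolated v -> e v u ->
    (v \in inset cfg') = (w u < w v) || (w u == w v) && (id u < id v)%N.
  move=> iv vu; have [_ vE _] := isolated_partner iv vu.
  rewrite insE finish_ins iv ifF; last first.
    by apply/negbTE; rewrite -lt0n; apply/card_gt0P; exists u; rewrite inE.
  apply/forallP/idP => [/(_ u)|le x]; first by rewrite vu.
  by rewrite vE; apply/implyP => /eqP ->.
have nisoE v : ~~ isolated v -> (v \in inset cfg') = (v \in inset cfg).
  move=> nv; rewrite insE finish_ins (negbTE nv); move: nv.
  by rewrite /isolated negb_or => /andP[/negbTE ->].
split.
  apply/forall_inP => x xS; apply/forall_inP => y yS; apply/negP => xy.
  case ix: (isolated x).
    have [iy _ _] := isolated_partner ix xy; have yx : e y x by rewrite eS.
    move: xS yS; rewrite (pairE x y) // (pairE y x) //.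
    by case: ltgtP => //= _; case: ltngtP.
  case iy: (isolated y).
    by have [] := isolated_partner iy (_ : e y x); rewrite ?ix // eS.
  move: xS yS; rewrite !nisoE ?ix ?iy // => xS yS.
  by have /forall_inP/(_ x xS)/forall_inP/(_ y yS) := ic; rewrite xy.
move=> I iI Iok.
pose f v := if v \in inset cfg' then v else odflt v [pick u | e v u].
have fP v : v \in I -> f v \in inset cfg' /\ w v <= w (f v) /\
    (f v = v \/ [/\ isolated v & e v (f v)]).
  move=> vI; rewrite /f; case vS: (v \in inset cfg'); first by split; rewrite ?vS //; split=> //; left.
  case iv: (isolated v); last first.
    by move: vS; rewrite nisoE ?iv // Iok ?iv.
  case: pickP => [u vu|no] /=.
    have [iu _ _] := isolated_partner iv vu; have uv : e u v by rewrite eS.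
    move: vS; rewrite (pairE v u) // (pairE u v) //.
    case: (ltgtP (w u) (w v)) => //= [lt _|_].
      by split=> //; split=> //; right.
    case: ltngtP => // [lt _|/id_inj uv' _]; last by rewrite uv' eI in vu.
    by split=> //; split=> //; right.
  move: vS; rewrite insE finish_ins ifT // cards_eq0; apply/eqP/setP => u.
  by rewrite !inE no.
have f_inj : {in I &, injective f}.
  have noI x y : x \in I -> y \in I -> e x y -> False.
    by move=> xI yI xy; have /forall_inP/(_ x xI)/forall_inP/(_ y yI) := iI; rewrite xy.
  move=> x y xI yI fxy; have [_ [_ hx]] := fP x xI; have [_ [_ hy]] := fP y yI.
  case: hx hy => [fx|[ix xf]] [fy|[iy yf]].
  - by rewrite -fx fxy fy.
  - by case: (noI y x) => //; rewrite -fx fxy.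
  - by case: (noI x y) => //; rewrite -fy -fxy.
  - have [_ _ uE] := isolated_partner ix xf.
    by apply/eqP; rewrite eq_sym -uE fxy eS.
apply: (@le_trans _ _ (\sum_(v in I) w (f v))).
  by apply: ler_sum => v /fP[_ []].
rewrite -(big_imset w f_inj) /weight /=.
rewrite [leRHS]big_mkcond [leLHS]big_mkcond; apply: ler_sum => v _.
case: imsetP => [[u uI ->]|_]; last by case: ifP.
by have [-> _] := fP u uI.
Qed.

End Finish.

(** * Message sizes and round count *)

Section Smallness.
Variables (L l : nat).
Hypothesis l0 : (0 < l)%N.

Lemma small_countdown f s d :
  (forall m, (s < m)%N -> (m <= s + d)%N -> small_prog L l (f m)) ->
  small_prog L l (countdown f s d).
Proof.
elim: d => [|d IH] h /=; first exact: small_prog_nil.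
apply: small_prog_cat; first by apply: h; rewrite // addnS ltnS leq_addr.
by apply: IH => m sm md; apply: h; rewrite // addnS ltnW.
Qed.

Lemma small_set_col c bl r : small L l r -> (c < 2 ^ L)%N -> (size bl <= l)%N ->
  all (fun n => (n < 2 ^ L)%N) bl -> small L l (set_col c bl r).
Proof.
move=> /and5P[h1 h2 h3 _ /and4P[_ _ h7 h8]] hc hs hb.
by apply/and5P; split => //; apply/and4P; split.
Qed.

Lemma small_nid r : small L l r -> (nid r < 2 ^ L)%N.
Proof. by case/and5P. Qed.

Lemma small_ncol r : small L l r -> (ncol r < 2 ^ L)%N.
Proof. by case/and5P. Qed.

Lemma small_nball r : small L l r -> all (fun n => (n < 2 ^ L)%N) (nball r).
Proof. by case/and5P=> _ _ _ _ /and4P[]. Qed.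

Lemma small_nwt r : small L l r -> small_rat L (nwt r).
Proof. by case/and5P. Qed.

Lemma size_cut (T : Type) (s : seq T) : (size (cut l s) <= l)%N.
Proof. by rewrite /cut; case: ifP. Qed.

Lemma all_cut (T : Type) (P : pred T) s : all P s -> all P (cut l s).
Proof. by rewrite /cut; case: ifP. Qed.

Lemma all_map_small (T : Type) (F : node -> T) (P : pred T) ns :
  (forall r, small L l r -> P (F r)) -> all (small L l) ns -> all P [seq F r | r <- ns].
Proof. by move=> h; elim: ns => //= r ns IH /andP[/h -> /IH]. Qed.

Lemma recolored_lt h m al c : hash_family h -> (0 < m)%N -> (2 * m <= L)%N ->
  (al < 2 ^ m)%N -> (al * 2 ^ m + h m al c < 2 ^ L)%N.
Proof.
move=> hh m0 mL alq; apply: (@leq_trans (2 ^ (2 * m))); last by rewrite leq_exp2l.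
exact: (recolor_lt (V := unit) hh m0 (fun=> c) tt alq).
Qed.

Lemma small_phase1 h s d g m n a : hash_family h -> (2 * (s + d) <= L)%N ->
  (trunc_log 2 n < L)%N -> small_prog L l (phase1 h s d g m n a).
Proof.
move=> hh sdL nL; apply: small_prog_cat.
  apply: small_prog_map => t; rewrite mem_iota add0n => /= tn r ns sr _.
  rewrite /peel; case: ifP => // _; case/and5P: sr => h1 h2 _ h4 h5.
  apply/and5P; split => //=; apply: leq_trans (ltn_expl t (isT : (1 < 2)%N)) _.
  by rewrite leq_exp2l // ltnW // (leq_trans tn).
apply: small_prog_cons; first by move=> r ns sr _; exact: sr.
apply: small_prog_cat; last first.
  by apply: small_prog_cons; [move=> r ns sr _; exact: sr|exact: small_prog_nil].
apply: small_prog_flatten => j _; apply: small_prog_cons.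
  by move=> r ns sr _; apply: small_set_col => //; apply: small_nid sr.
apply: small_prog_cat; last by apply: small_prog_map => i _ r ns sr _; exact: sr.
apply: small_countdown => i si isd; apply: small_prog_cons; last exact: small_prog_nil.
move=> r ns sr _; apply: small_set_col => //; apply: recolored_lt => //.
- exact: leq_ltn_trans si.
- by apply: leq_trans sdL; rewrite leq_mul2l isd orbT.
- by apply: first_below_lt; rewrite expn_gt0.
Qed.

Lemma small_phase2 h theta D s d N : hash_family h -> (0 < L)%N -> (2 * (s + d) <= L)%N ->
  small_prog L l (phase2 h theta D l s d N).
Proof.
move=> hh Lpos sdL; apply: small_prog_cat.
  do 3![apply: small_prog_cons; first by move=> r ns sr _; exact: sr].
  apply: small_prog_cons.
    move=> r ns sr sns; apply: small_set_col => //; rewrite ?size_cut ?(small_ncol sr) //.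
    by apply: all_cut; apply: all_map_small sns; exact: small_nid.
  by apply: small_prog_cons; [move=> r ns sr _; exact: sr|exact: small_prog_nil].
apply: small_prog_cat; last first.
  apply: small_prog_flatten => j _.
  rewrite /program_sweep; elim: (turn_list _) => [|t ts IH] /=; first exact: small_prog_nil.
  apply: small_prog_cat => //; case: t => -[] k; rewrite /program_turn /=; last first.
    by do 2![apply: small_prog_cons; first by move=> r ns sr _; exact: sr].
  apply: small_prog_cons; last first.
    by do 3![apply: small_prog_cons; first by move=> r ns sr _; exact: sr].
  move=> r ns sr sns; have [h1 h2 h3 h4 /and4P[h5 h6 _ _]] := and5P sr.
  apply/and5P; split => //; apply/and4P; split => //; rewrite ?size_cut //.
  apply: all_cut => /=.
  have L0 : (0 < 2 ^ L)%N by rewrite expn_gt0.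
  have own_small x : small L l x -> small_rat L (own x).
    move=> sx; rewrite /own; case: (nins x); first exact: small_nwt.
    by rewrite /small_rat /= L0 (leq_trans _ (ltn_expl L (isT : (1 < 2)%N))).
  by rewrite own_small //=; apply: all_map_small sns.
apply: small_prog_cons.
  move=> r ns sr _; apply: small_set_col => //=; rewrite ?(small_nid sr) //.
apply: small_countdown => i si isd.
have gather_small : small_step L l (gather l).
  move=> r ns sr sns; apply: small_set_col => //; rewrite ?size_cut ?(small_ncol sr) //.
  apply: all_cut; rewrite all_cat small_nball //=.
  by elim: ns sns => //= x ns IH /andP[sx sns]; rewrite all_cat small_nball //= IH.
do 3![apply: small_prog_cons => //].
apply: small_prog_cons; last exact: small_prog_nil.
move=> r ns sr _; have lt : (first_below (fun al =>
     all (fun c => (c != ncol r) ==> (h i al c != h i al (ncol r))) (nball r)) (2 ^ i) < 2 ^ i)%N.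
  by apply: first_below_lt; rewrite expn_gt0.
have lt2 : (2 * i <= L)%N by apply: leq_trans sdL; rewrite leq_mul2l isd orbT.
have i0 : (0 < i)%N by apply: leq_ltn_trans si.
have := recolored_lt (ncol r) hh i0 lt2 lt => ltL.
by apply: small_set_col => //=; rewrite ltL.
Qed.

Lemma small_finish : small_prog L l finish.
Proof. by do 2![apply: small_prog_cons; first by move=> r ns sr _; exact: sr]. Qed.

Lemma small_init i x : (i < 2 ^ L)%N -> small_rat L x -> small L l (init_node i x).
Proof. by move=> hi hx; rewrite /small /= hi hx !expn_gt0. Qed.

End Smallness.

Lemma size_countdown f s d c : (forall m, size (f m) = c) ->
  size (countdown f s d) = (c * d)%N.
Proof. by move=> sf; elim: d => [|d IH] /=; rewrite ?muln0 // size_cat sf IH mulnS. Qed.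

Lemma size_flatten_const (T : Type) (f : nat -> seq T) c s :
  (forall i, size (f i) = c) -> size (flatten [seq f i | i <- s]) = (size s * c)%N.
Proof. by move=> sf; elim: s => //= i s IH; rewrite size_cat sf IH mulSn. Qed.

Lemma size_phase1 h s d g m n a : size (phase1 h s d g m n a) =
  ((trunc_log 2 n).+1 + (1 + (m * (1 + (d + 2 ^ (3 * s))) + 1)))%N.
Proof.
rewrite /phase1 /rounding !size_cat size_map size_iota /= size_cat.
rewrite (size_flatten_const (c := (1 + (d + 2 ^ (3 * s)))%N)) ?size_iota //=.
by move=> j; rewrite /= size_cat (size_countdown _ _ (c := 1%N)) // mul1n size_map size_iota.
Qed.

Lemma size_phase2 h theta D l s d N : size (phase2 h theta D l s d N) =
  (5 + ((1 + 4 * d) + N * (6 * 2 ^ (3 * s))))%N.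
Proof.
rewrite /phase2 !size_cat /= (size_countdown _ _ (c := 4%N)) //.
rewrite (size_flatten_const (c := (6 * 2 ^ (3 * s))%N)) ?size_iota //= => _.
rewrite /program_sweep /turn_list map_cat flatten_cat size_cat -!map_comp.
by rewrite (size_flatten_const (c := 2%N)) // (size_flatten_const (c := 4%N)) // size_iota; lia.
Qed.

(** * The algorithm *)

Record constants := Constants {
  p_k : nat; p_hash : nat -> nat -> nat -> nat;
  p_s1 : nat; p_growth : rat; p_steps : nat -> nat;
  p_theta : rat; p_D : nat; p_len : nat; p_s2 : nat; p_sweeps : nat }.

(** Enough bits for an identifier below $n^k$; it also serves as the number of recoloring rounds. *)
Definition id_digits (P : constants) (n : nat) : nat := (p_k P * (trunc_log 2 n).+1)%N.

Definition mwis_program (P : constants) (n a : nat) : seq step :=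
  phase1 (p_hash P) (p_s1 P) (id_digits P n) (p_growth P) (p_steps P a) n a ++
  phase2 (p_hash P) (p_theta P) (p_D P) (p_len P) (p_s2 P) (id_digits P n) (p_sweeps P) ++
  finish.

Definition valid (P : constants) (z : rat) : Prop :=
  [/\ hash_family (p_hash P), (1 < p_s1 P)%N, 0 <= p_growth P,
      p_growth P * (1 + 2%:R / (2 ^ p_s1 P)%:R) <= 2%:R
    & forall a, (0 < a)%N -> (8 * a)%:R <= p_growth P ^+ p_steps P a] /\
  [/\ (1 < p_s2 P)%N, (2 * p_len P < 2 ^ p_s2 P)%N, ((p_D P).+1 ^ 3 <= p_len P)%N,
      0 < z /\ p_theta P = 1 + z
    & 8%:R * (2 ^ (3 * p_s2 P))%:R * (p_D P)%:R * z <= 1].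

Section Correctness.
Variables (P : constants) (z : rat).
Hypothesis vP : valid P z.
Variables (V : finType) (e : rel V) (a : nat) (w : V -> rat) (id : V -> nat) (ports : V -> seq V).
Hypotheses (ge : simple_graph e) (ha : forest_partition e a).
Hypotheses (w0 : forall v, 0 <= w v) (hid : log_bit_ids (p_k P) id) (hp : port_numbering e ports).
Hypothesis hw : log_bit_weights w (p_k P).

Let cfg0 v := init_node (id v) (w v).
Let X := inset (run ports (mwis_program P #|V| a) cfg0).

Lemma pow_card_le : (#|V| ^ p_k P <= 2 ^ id_digits P #|V|)%N.
Proof.
rewrite /id_digits mulnC expnM; case: (p_k P) => [|k]; first by rewrite !expn0.
by rewrite leq_exp2r // ltnW // trunc_log_ltn.
Qed.

Lemma id_small s v : (id v < 2 ^ (3 * (s + id_digits P #|V|)))%N.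
Proof.
apply: leq_trans (hid.2 v) _; apply: leq_trans pow_card_le _.
by rewrite leq_exp2l //; lia.
Qed.

Lemma program_correct : (0 < a)%N ->
  [/\ independent e X,
      forall O, weight w O <= (2 ^ (p_steps P a).+1)%:R * weight w X,
      (forall v, (#|neighbors e v| <= 1)%N) ->
        forall O, independent e O -> weight w O <= weight w X
    & forall M, (1 < M)%N -> (M <= p_D P)%N -> (forall v, (#|neighbors e v| <= M)%N) ->
        (2 ^ (p_steps P a).+1)%:R <= (1 + z ^+ 2 / 2%:R) ^+ p_sweeps P ->
        forall O, independent e O ->
        weight w O <= (M%:R - (2%:R * (2 ^ (3 * p_s2 P))%:R)^-1) * weight w X].
Proof.
move=> a0; have [[hh s1 g0 gs steps] [s2 ls Dl [z0 thE] zs]] := vP.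
have [eS eI] := ge; have [id_inj _] := hid.
have th1 : 1 < p_theta P by rewrite thE ltrDl.
have [st1 i1 r1] := phase1_correct eS eI w0 hp id_inj
  (fun U => arboricity_degree_sum U ge ha) hh s1 a0 (id_small (p_s1 P)) g0 gs (steps a a0).
rewrite /X /mwis_program run_cat run_cat.
set cfg1 := run ports (phase1 _ _ _ _ _ _ _) _ in st1 i1 r1 *.
rewrite -/(inset cfg1) in i1 r1.
have [st2 i2 le2 alt] := phase2_correct eS eI w0 hp id_inj (p_sweeps P) hh s2 ls Dl th1
  (id_small (p_s2 P)) st1 i1.
set cfg2 := run ports (phase2 _ _ _ _ _ _ _) _ in st2 i2 le2 alt *.
have [i3 best] := finish_correct eS eI w0 hp id_inj st2 i2.
set cfg3 := run ports finish cfg2 in i3 best *.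
have le3 : weight w (inset cfg2) <= weight w (inset cfg3) by apply: best.
have wV O : weight w O <= (2 ^ (p_steps P a).+1)%:R * weight w (inset cfg1).
  apply: le_trans r1; rewrite /weight big_mkcond [leRHS]big_mkcond.
  by apply: ler_sum => v _; rewrite inE; case: ifP.
have wS (S : {set V}) : 0 <= weight w S by apply: sumr_ge0.
split => //.
- move=> O; apply: le_trans (wV O) _; rewrite ler_wpM2l //; exact: le_trans le2 le3.
- move=> deg1 O iO; apply: best => // v _ /negP[]; rewrite /isolated.
  case: (posnP #|neighbors e v|) => //= dv.
  have -> : #|neighbors e v| == 1%N by rewrite eqn_leq deg1.
  apply/forallP => u; apply/implyP => vu; rewrite eqn_leq deg1 /=.
  by apply/card_gt0P; exists v; rewrite inE eS.
- move=> M M1 MD degM grow O iO.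
  have c1 : 1 <= M%:R - (2%:R * (2 ^ (3 * p_s2 P))%:R)^-1 :> rat.
    have K0 : (0 < 2 ^ (3 * p_s2 P))%N by rewrite expn_gt0.
    rewrite lerBrDr; apply: (@le_trans _ _ (1 + 1)); last by rewrite -(natrD _ 1 1) ler_nat.
    by rewrite lerD2l invf_le1 -natrM ?ler1n ?ltr0n muln_gt0.
  have c0 := le_trans ler01 c1.
  apply: (@le_trans _ _ ((M%:R - (2%:R * (2 ^ (3 * p_s2 P))%:R)^-1) * weight w (inset cfg2))); last first.
    by rewrite ler_wpM2l.
  (* If the gains multiplied through all sweeps, they outweigh the loss of phase one, and the
     solution is at least as heavy as any set of nodes. *)
  case: (alt M O z) => // le; apply: le_trans (wV O) _.
  apply: (@le_trans _ _ (weight w (inset cfg2))); last by rewrite ler_peMl.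
  by apply: le_trans le; rewrite ler_wpM2r.
Qed.

Definition bits : nat := (3 * (p_s1 P + p_s2 P + id_digits P #|V|) + (trunc_log 2 #|V|).+2)%N.

Lemma program_message_bound (R : realType) (b : R) :
  ((15 + 4 * p_len P) * (2 * bits + 2))%:R <= b ->
  message_bound w (broadcast_algorithm (mwis_program P)) a id ports b.
Proof.
have [[hh _ _ _ _] [_ _ Dl _ _]] := vP => hb.
have l0 : (0 < p_len P)%N by apply: leq_trans Dl; rewrite expn_gt0.
apply: broadcast_message_bound hb; first by rewrite /bits addnS.
  apply: small_prog_cat; first by apply: small_phase1 => //; rewrite /bits; lia.
  apply: small_prog_cat; last exact: small_finish.
  by apply: small_phase2 => //; rewrite /bits; lia.
move=> v; have dig x : (x <= #|V| ^ p_k P)%N -> (x < 2 ^ bits)%N.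
  move=> hx; apply: leq_ltn_trans hx _; apply: leq_ltn_trans pow_card_le _.
  by rewrite ltn_exp2l // /bits; lia.
apply: small_init; first by apply: dig; rewrite ltnW // hid.2.
have [hn hd] := hw v; rewrite /small_rat /= !dig //.
by apply: leq_trans (leq_b1 _) _; rewrite expn_gt0; apply/orP; left; apply/card_gt0P; exists v.
Qed.

Lemma program_size : (size (mwis_program P #|V| a) <=
  (20 + 5 * p_k P + 2 ^ (3 * p_s1 P) + 6 * 2 ^ (3 * p_s2 P) * p_sweeps P) *
  (p_steps P a).+1 * (trunc_log 2 #|V|).+1)%N.
Proof.
rewrite /mwis_program size_cat size_cat size_phase1 size_phase2 /id_digits /=.
move: (2 ^ (3 * p_s1 P))%N (2 ^ (3 * p_s2 P))%N (trunc_log 2 #|V|) (p_steps P a) (p_k P) (p_sweeps P).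
move=> A B t m k N; nia.
Qed.

End Correctness.

Lemma OPT_le (V : finType) (e : rel V) (w : V -> rat) (q : rat) : 0 <= q ->
  (forall O, independent e O -> weight w O <= q) -> OPT e w <= q.
Proof. by move=> q0 h; rewrite /OPT; elim/big_ind: _ => // x y; rewrite ge_max => -> ->. Qed.

(** * Choice of the constants *)

Lemma bernoulli (F : realFieldType) (t : F) L : 0 <= t -> 1 + t * L%:R <= (1 + t) ^+ L.
Proof.
move=> t0; elim: L => [|L IH]; first by rewrite mulr0 addr0 expr0.
rewrite exprS -natr1; have L0 : 0 <= L%:R :> F by [].
have := ler_wpM2l (addr_ge0 ler01 t0) IH; apply: le_trans; nra.
Qed.

Lemma geometric_unbounded (t B : rat) : 0 < t -> exists L, B <= (1 + t) ^+ L.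
Proof.
move=> t0; have [b0|b0] := leP B 0.
  by exists 0%N; rewrite expr0 (le_trans b0).
exists (Num.Def.archi_bound (B / t)); apply: le_trans (bernoulli _ (ltW t0)).
have : B / t < (Num.Def.archi_bound (B / t))%:R by apply: archi_boundP; rewrite divr_ge0 ?ltW.
by rewrite ltr_pdivrMr // mulrC => /ltW h; rewrite (le_trans h) // lerDr.
Qed.

Lemma steps_exist (g : rat) : 1 < g -> exists steps : nat -> nat, forall a, (0 < a)%N ->
  (8 * a)%:R <= g ^+ steps a /\ g ^+ steps a <= g * (8 * a)%:R.
Proof.
move=> g1; suff /boolp.choice[f hf] : forall a : nat, exists m : nat, (0 < a)%N ->
    (8 * a)%:R <= g ^+ m /\ g ^+ m <= g * (8 * a)%:R by exists f.
move=> a; case: (posnP a) => [->|a0]; first by exists 0%N.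
have ex : exists m, (8 * a)%:R <= g ^+ m.
  have [|L hL] := @geometric_unbounded (g - 1) (8 * a)%:R; first by rewrite subr_gt0.
  by exists L; move: hL; rewrite addrC subrK.
exists (ex_minn ex) => _; case: ex_minnP => -[|m] hm min; split => //.
  by rewrite expr0 -[1]mulr1 ler_pM ?(ltW g1) // ler1n muln_gt0.
rewrite exprS ler_pM2l ?(lt_trans _ g1) //; case: (leP ((8 * a)%:R) (g ^+ m)) => [/min|/ltW //].
by rewrite ltnn.
Qed.

Lemma pow2_exceeds n : exists s, (1 < s)%N /\ (n < 2 ^ s)%N.
Proof. by exists n.+2; split=> //; apply: leq_trans (ltn_expl _ _) => //; lia. Qed.

Lemma bits_le s1 s2 k t l :
  ((15 + 4 * l) * (2 * (3 * (s1 + s2 + k * t.+1) + t.+2) + 2) <=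
   (15 + 4 * l) * (2 * (3 * (s1 + s2 + k) + 2) + 2) * t.+1)%N.
Proof. by rewrite -mulnA leq_mul2l; apply/orP; right; nia. Qed.

Section Reals.
Variable R : realType.

Lemma powR_le (x y r : R) : 0 <= r -> 0 <= x -> x <= y -> x `^ r <= y `^ r.
Proof.
by move=> r0 x0 xy; apply: ge0_ler_powR; rewrite ?nnegrE // (le_trans x0).
Qed.

(** Since $2^{1/(1+x)}<2$, some $2-1/N$ lies in between. With this growth rate, halving costs
    $2^m\le(g^m)^{1+x}$ in total. *)
Lemma growth_exists (x : R) : 0 < x ->
  exists N : nat, (1 < N)%N /\ 2%:R <= (2%:R - N%:R^-1) `^ (1 + x) :> R.
Proof.
move=> x0; set q := (1 + x)^-1; have q0 : 0 < q by rewrite invr_gt0 addr_gt0.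
have q1 : q < 1 by rewrite invf_lt1 ?addr_gt0 // ltrDl.
have ln2 : 0 < ln (2%:R : R) by rewrite ln_gt0 // ltr1n.
have y0 : 0 < (2%:R : R) `^ q by apply: powR_gt0.
have y2 : (2%:R : R) `^ q < 2%:R.
  rewrite ltNge -ler_ln ?posrE // ln_powR -ltNge.
  by rewrite -[X in _ < X]mul1r ltr_pM2r.
set dl := 2%:R - 2%:R `^ q; have dl0 : 0 < dl by rewrite subr_gt0.
pose N := (Num.Def.archi_bound dl^-1).+2.
have Nb : dl^-1 < N%:R.
  apply: (lt_trans (archi_boundP _)); first by rewrite invr_ge0 ltW.
  by rewrite ltr_nat.
exists N; split => //.
have le : 2%:R `^ q <= 2%:R - N%:R^-1 :> R.
  rewrite lerBrDl -lerBrDr -/dl -[dl]invrK lef_pV2 ?posrE ?invr_gt0 ?ltr0n //.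
  exact: ltW.
have := powR_le (ltW (addr_gt0 ltr01 x0)) (ltW y0) le.
by rewrite -powRrM mulVf ?powRr1 // gt_eqF // addr_gt0.
Qed.

(** Here $g^m\le16a$, and $16^{1+x}\le16^2$; one more factor 2 gives $512=2\cdot256$. *)
Lemma ratio_bound (x : R) (N a m : nat) : 0 < x -> x <= 1 -> (1 < N)%N ->
    2%:R <= (2%:R - N%:R^-1) `^ (1 + x) :> R -> (0 < a)%N ->
    (2%:R - N%:R^-1) ^+ m <= (2%:R - N%:R^-1) * (8 * a)%:R :> R ->
  (2 ^ m.+1)%:R <= 512%:R * a%:R `^ (1 + x) :> R.
Proof.
move=> x0 x1 N1 grow a0 gm; set g : R := 2%:R - N%:R^-1 in grow gm.
have Ninv : 0 < N%:R^-1 :> R by rewrite invr_gt0 ltr0n ltnW.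
have Ninv1 : N%:R^-1 <= 1 :> R by rewrite invf_le1 ?ler1n ?ltr0n ltnW.
have g0 : 0 <= g by rewrite /g; lra.
have g2 : g <= 2%:R by rewrite /g; lra.
have x10 : 0 <= 1 + x by lra.
have gm16 : g ^+ m <= (16 * a)%:R.
  apply: le_trans gm _; rewrite (_ : 16 * a = 2 * (8 * a))%N; last by lia.
  by rewrite [X in _ <= X]natrM ler_wpM2r.
have pow2 : (2 ^ m)%:R <= (16 * a)%:R `^ (1 + x) :> R.
  rewrite natrX; apply: (@le_trans _ _ ((g `^ (1 + x)) ^+ m)).
    by rewrite lerXn2r ?nnegrE ?powR_ge0.
  rewrite -powR_mulrn ?powR_ge0 // powRAC powR_mulrn //.
  by apply: powR_le; rewrite ?exprn_ge0.
rewrite expnS natrM; rewrite natrM powRM // in pow2.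
have p16 : 16%:R `^ (1 + x) <= 256%:R :> R.
  apply: (@le_trans _ _ (16%:R `^ 2%:R)); first by apply: ler_powR; [rewrite ler1n|lra].
  by rewrite powR_mulrn // -natrX.
have := ler_wpM2r (powR_ge0 a%:R (1 + x)) p16.
move: pow2; rewrite (_ : 512%:R = 2%:R * 256%:R); last by rewrite -natrM.
rewrite -[_ * 256%:R * _]mulrA ler_pM2l ?ltr0n //; exact: le_trans.
Qed.

Lemma degree_threshold (c : R) : 0 < c -> exists D : nat, (0 < D)%N /\ 512%:R <= D%:R `^ (c / 4%:R).
Proof.
move=> c0; set y : R := 512%:R `^ (4%:R / c).
exists (Num.Def.archi_bound y).+1; split => //.
have yD : y <= (Num.Def.archi_bound y).+1%:R.
  apply: ltW; apply: lt_trans (archi_boundP (powR_ge0 _ _)) _; by rewrite ltr_nat.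
apply: le_trans (powR_le _ (powR_ge0 _ _) yD); last by rewrite divr_ge0 ?ltW.
rewrite -powRrM (_ : 4%:R / c * (c / 4%:R) = 1) ?powRr1 //.
by field; rewrite gt_eqF.
Qed.

(** From $\ln t\le t-1$ at $t=M^{-c'}$ and $\ln M\le M$ follows $M^{-c'}\ge1-c'M$, so the ratio
    loses at most $c'M^2\le c'D^2\le1/(2K)$. *)
Lemma small_degree_ratio (c' : R) (M D K : nat) : (1 < M)%N -> (M <= D)%N -> (0 < K)%N ->
    0 < c' -> c' <= (2 * K * D ^ 2)%:R^-1 ->
  M%:R - (2 * K)%:R^-1 <= M%:R `^ (1 - c').
Proof.
move=> M1 MD K0 c0 cle; have M0 : 0 < M%:R :> R by rewrite ltr0n ltnW.
rewrite powRB; last by rewrite (gt_eqF M0) implybT.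
rewrite powRr1 ?(ltW M0) // -powRN.
set t := M%:R `^ - c'; have t0 : 0 < t by apply: powR_gt0.
have : ln t <= t - 1.
  by rewrite -{1}[t](subrK 1) addrC le_ln1Dx // ltrBrDl subrr.
rewrite ln_powR => lnt.
have lnM' : ln (M%:R : R) <= M%:R by apply: ltW; apply: ln_sublinear.
have t1 : 1 - c' * M%:R <= t by have := ler_wpM2l (ltW c0) lnM'; lra.
apply: le_trans (ler_wpM2l (ltW M0) t1); rewrite mulrBr mulr1 lerD2l lerN2.
have -> : M%:R * (c' * M%:R) = c' * (M ^ 2)%:R by rewrite natrX expr2 mulrCA.
have D0 : (0 < D)%N by apply: leq_trans MD; apply: ltnW.
apply: (@le_trans _ _ ((2 * K * D ^ 2)%:R^-1 * (D ^ 2)%:R)).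
  by apply: ler_pM; rewrite ?(ltW c0) // ler_nat leq_exp2r.
rewrite natrM invfM -mulrA mulVf ?mulr1 //.
by rewrite pnatr_eq0 expn_eq0 negb_and -lt0n D0.
Qed.

Lemma log2_card (n : nat) : (1 < n)%N ->
  ((trunc_log 2 n).+1)%:R <= 2%:R / ln 2%:R * ln (n%:R) :> R.
Proof.
move=> n1; have ln2 : 0 < ln (2%:R : R) by rewrite ln_gt0 // ltr1n.
have n0 : (0 < n)%N by apply: ltnW.
have lnn : ln (2%:R : R) <= ln (n%:R : R) by rewrite ler_ln ?posrE ?ltr0n // ler_nat.
have tr : ln (2%:R : R) * (trunc_log 2 n)%:R <= ln (n%:R : R).
  rewrite mulr_natr -lnXn ?ltr0n // -natrX ler_ln ?posrE ?ltr0n ?expn_gt0 //.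
  by rewrite ler_nat trunc_logP.
rewrite mulrAC ler_pdivlMr // -natr1; move: tr; lra.
Qed.

Lemma steps_log (g : R) (a m : nat) : 1 < g -> g <= 2%:R -> (0 < a)%N ->
    g ^+ m <= g * (8 * a)%:R ->
  m.+1%:R <= (1 + ln 16%:R / ln g + (ln g)^-1) * (1 + ln a%:R).
Proof.
move=> g1 g2 a0 gm; have lg : 0 < ln g by rewrite ln_gt0.
have ag : 0 <= ln (a%:R : R) by rewrite ln_ge0 // ler1n.
have l16 : 0 <= ln (16%:R : R) by rewrite ln_ge0 // ler1n.
have g0 : 0 < g by apply: lt_trans g1.
have : ln (g ^+ m) <= ln ((16 * a)%:R : R).
  rewrite ler_ln ?posrE ?exprn_gt0 ?ltr0n ?muln_gt0 //.
  apply: le_trans gm _; rewrite (_ : 16 * a = 2 * (8 * a))%N; last by lia.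
  by rewrite [X in _ <= X]natrM ler_wpM2r.
rewrite lnXn // natrM lnM ?posrE ?ltr0n // -[ln g *+ m]mulr_natl => le.
have mle : m%:R <= (ln 16%:R + ln a%:R) / ln g by rewrite ler_pdivlMr.
rewrite -natr1; apply: le_trans (lerD mle (lexx _)) _.
set u := (ln g)^-1; have u0 : 0 <= u by rewrite invr_ge0 ltW.
rewrite mulrDl -!/u; have := mulr_ge0 (mulr_ge0 l16 u0) ag; have := mulr_ge0 u0 ag.
rewrite !mulrDl !mulrDr !mulr1 mul1r; move: ag u0; lra.
Qed.

Lemma approximation_le (V : finType) (e : rel V) (w : V -> rat) (q : rat) (Q : R) (X : {set V}) :
    (forall v, 0 <= w v) -> 0 <= q -> independent e X -> ratr q <= Q ->
    (forall O, independent e O -> weight w O <= q * weight w X) ->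
  is_approximation e w Q X.
Proof.
move=> w0 q0 iX qQ h; split => //.
have wX : 0 <= weight w X by apply: sumr_ge0.
apply: (@le_trans _ _ (ratr q * ratr (weight w X))); last by rewrite ler_wpM2r ?ler0q.
by rewrite -rmorphM ler_rat; apply: OPT_le; rewrite // mulr_ge0.
Qed.

End Reals.

Lemma max_degree_edge (V : finType) (e : rel V) :
  (0 < max_degree e)%N -> exists u v, e u v.
Proof.
move=> d0; apply: contrapT => no; move: d0; rewrite /max_degree big1 // => v _.
apply/eqP; rewrite cards_eq0; apply/eqP/setP => u; rewrite !inE.
by apply/negbTE/negP => vu; apply: no; exists v, u.
Qed.

Theorem theorem4p10 (R : realType) (c : R) (hc : 0 < c) :
  exists2 c' : R, 0 < c' &
  forall k : nat, exists (A : congest_algorithm) (B C : R),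
  forall (V : finType) (e : rel V) (a : nat) (w : V -> rat)
         (id : V -> nat) (ports : V -> seq V),
    simple_graph e ->
    is_arboricity e a ->
    (0 < max_degree e)%N ->
    a%:R <= (max_degree e)%:R `^ (1 - c) ->
    (forall v, 0 <= w v) ->
    log_bit_weights w k ->
    log_bit_ids k id ->
    port_numbering e ports ->
    message_bound w A a id ports (B * ln (#|V|%:R)) /\
    exists (T : nat) (X : {set V}),
      [/\ T%:R <= C * (1 + ln (a%:R)) * ln (#|V|%:R),
          computes_in w A a id ports T X
        & is_approximation e w ((max_degree e)%:R `^ (1 - c')) X].
Proof.
(* Lowering $c$ only weakens the hypothesis on $a$, as Delta is at least 1; the cap 1/2 keeps the
   exponent $1+c_0/2$ below 2. *)
pose c0 : R := Num.min c (1 / 2%:R).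
have c00 : 0 < c0 by rewrite lt_min hc divr_gt0.
have c0c : c0 <= c by rewrite ge_min lexx.
have c0h : c0 <= 1 / 2%:R by rewrite ge_min lexx orbT.
have [h hash_h] := hash_family_exists.
(* The loss exponent is $1+c_0/2$ because $(1-c_0)(1+c_0/2)\le1-c_0/2$ still saves half of $c_0$. *)
have x0 : 0 < c0 / 2%:R by rewrite divr_gt0.
have [N [N1 grow]] := growth_exists x0.
have [D [D0 D512]] := degree_threshold c00.
pose g : rat := 2%:R - N%:R^-1.
have Ninv : 0 < N%:R^-1 :> rat by rewrite invr_gt0 ltr0n ltnW.
have Nhalf : N%:R^-1 <= 1 / 2%:R :> rat.
  by rewrite mul1r lef_pV2 ?posrE ?ltr0n ?ler_nat // ltnW.
have g1 : 1 < g by rewrite /g; lra.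
have g2 : g <= 2%:R by rewrite /g; lra.
have ratr_g : ratr g = 2%:R - N%:R^-1 :> R by rewrite /g rmorphB fmorphV /= !ratr_nat.
have [steps stepsP] := steps_exist g1.
have [l [l0 Dl]] : exists l, (0 < l)%N /\ (D.+1 ^ 3 <= l)%N.
  by exists (D.+1 ^ 3)%N; rewrite expn_gt0.
have [s1 [s11 Ns1]] : exists s1, (1 < s1)%N /\ (4 * N <= 2 ^ s1)%N.
  by have [s [s1 /ltnW]] := pow2_exceeds (4 * N); exists s.
have [s2 [s21 ls2]] : exists s2, (1 < s2)%N /\ (2 * l < 2 ^ s2)%N.
  exact: pow2_exceeds.
pose K := (2 ^ (3 * s2))%N.
have K0 : (0 < K)%N by rewrite expn_gt0.
pose z : rat := (8 * K * D)%:R^-1.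
have z0 : 0 < z by rewrite invr_gt0 ltr0n !muln_gt0 K0.
(* For Delta at most [D] phase one loses at most a factor $512D$, which [L] successful sweeps
   recover. *)
have [L hL] := @geometric_unbounded (z ^+ 2 / 2%:R) (512 * D)%:R
  ltac:(by rewrite divr_gt0 // exprn_gt0).
pose P k := Constants k h s1 g steps (1 + z) D l s2 L.
have vP k : valid (P k) z.
  split; split => //=.
  - exact: ltW (lt_trans ltr01 g1).
  (* As $g\le2$, the defect costs at most $g/(2N)\le1/N=2-g$. *)
  - have small : 2%:R / (2 ^ s1)%:R <= N%:R^-1 / 2%:R :> rat.
      have p0 : 0 < (2 ^ s1)%:R :> rat by rewrite ltr0n expn_gt0.
      rewrite ler_pdivrMr // mulrAC ler_pdivlMr // [N%:R^-1 * _]mulrC.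
      rewrite ler_pdivlMr; last by rewrite ltr0n ltnW.
      by rewrite -!natrM ler_nat.
    have := ler_wpM2l (ltW (lt_trans ltr01 g1)) small.
    rewrite mulrDr mulr1 /g; move: Ninv; move: (N%:R^-1) (2%:R / _) => i q i0; nra.
  - by move=> a a0; have [] := stepsP a a0.
  - rewrite -!natrM mulfV // pnatr_eq0 -lt0n !muln_gt0 K0 //.
(* The first term serves degrees above [D], the second the degrees from 2 to [D]. *)
pose c' : R := Num.min (c0 / 4%:R) (2 * K * D ^ 2)%:R^-1.
have c'0 : 0 < c'.
  by rewrite lt_min divr_gt0 //= invr_gt0 ltr0n !muln_gt0 K0 ?expn_gt0 D0.
exists c' => // k.
pose Cc := (20 + 5 * k + 2 ^ (3 * s1) + 6 * K * L)%N.
pose B : R := ((15 + 4 * l) * (2 * (3 * (s1 + s2 + k) + 2) + 2))%:R * (2%:R / ln 2%:R).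
pose gR : R := ratr g.
pose C : R := Cc%:R * (1 + ln 16%:R / ln gR + (ln gR)^-1) * (2%:R / ln 2%:R).
exists (broadcast_algorithm (mwis_program (P k))), B, C.
move=> V e a w id ports ge [fa _] d0 ha w0 hw hid hp.
have [u [v uv]] := max_degree_edge d0.
have a0 : (0 < a)%N.
  by have [part [_ pa _]] := fa; apply: leq_trans (pa u v uv).
have n1 : (1 < #|V|)%N.
  have uNv : u != v by apply: contraTneq uv => ->; rewrite ge.2.
  by have := max_card [set u; v]; rewrite cards2 uNv.
have lnn := @log2_card R _ n1.
have gR1 : 1 < gR by rewrite -[1](ratr_nat R 1) ltr_rat.
have gR2 : gR <= 2%:R by rewrite -(ratr_nat R 2) ler_rat.
have gm : gR ^+ steps a <= gR * (8 * a)%:R.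
  by rewrite -(ratr_nat R) -rmorphXn -rmorphM ler_rat; have [] := stepsP a a0.
split.
  apply: (program_message_bound (vP k) a hid hw) => //=.
  apply: (@le_trans _ _ (((15 + 4 * l) * (2 * (3 * (s1 + s2 + k) + 2) + 2) *
    (trunc_log 2 #|V|).+1)%:R)).
    by rewrite ler_nat; apply: bits_le.
  by rewrite [X in X <= _]natrM /B -mulrA ler_wpM2l.
have [iX ratio exact1 small] := program_correct (vP k) ge fa w0 hid hp a0.
exists (size (mwis_program (P k) #|V| a)), (inset (run ports (mwis_program (P k) #|V| a)
  (fun v => init_node (id v) (w v)))); split.
- apply: (@le_trans _ _ ((Cc * (steps a).+1 * (trunc_log 2 #|V|).+1)%:R)).
    by rewrite ler_nat; apply: program_size.
  have st := steps_log gR1 gR2 a0 gm; rewrite natrM [X in X * _]natrM /C.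
  have -> (p q r x y : R) : p * q * r * x * y = p * (q * x) * (r * y) by ring.
  by apply: ler_pM => //; rewrite ?mulr_ge0 // ler_wpM2l.
- exact: broadcast_computes.
set M := max_degree e in d0 ha *.
have degM x : (#|neighbors e x| <= M)%N by apply: (leq_bigmax x).
have M1 : 1 <= M%:R :> R by rewrite ler1n.
have M0 : 0 < M%:R :> R by rewrite ltr0n.
have key : (2 ^ (steps a).+1)%:R <= 512%:R * M%:R `^ (1 - c0 / 2%:R) :> R.
  apply: le_trans (ratio_bound x0 _ N1 grow a0 _) _.
  - by lra.
  - by rewrite -ratr_g.
  rewrite ler_wpM2l //; have ac0 : a%:R <= M%:R `^ (1 - c0) :> R.
    by apply: le_trans ha _; apply: ler_powR; rewrite // lerD2l lerN2.
  apply: le_trans (powR_le _ _ ac0) _ => //; first by lra.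
  by rewrite -powRrM; apply: ler_powR => //; nra.
case: (leqP M 1) => [Mle1|M2].
  have M1n : M = 1%N by apply/eqP; rewrite eqn_leq Mle1.
  apply: (approximation_le (q := 1)) => //; first by rewrite M1n powR1 rmorph1.
  by move=> O iO; rewrite mul1r; apply: exact1 => // x; rewrite -M1n.
case: (leqP M D) => MD.
  apply: (approximation_le (q := M%:R - (2%:R * K%:R)^-1)) => //.
  - rewrite subr_ge0; apply: (@le_trans _ _ 1); last by rewrite ler1n ltnW.
    by rewrite invf_le1 -natrM ?ler1n ?ltr0n muln_gt0.
  - rewrite rmorphB fmorphV rmorphM /= !ratr_nat -natrM.
    by apply: small_degree_ratio MD _ c'0 _ => //; rewrite ge_min lexx orbT.
  - apply: small => //=; apply: le_trans hL; rewrite ler_nat -(ler_nat R).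
    apply: le_trans key _; rewrite natrM ler_wpM2l //.
    apply: (@le_trans _ _ M%:R); last by rewrite ler_nat.
    by apply: ler1_powR => //; lra.
apply: (approximation_le (q := (2 ^ (steps a).+1)%:R)) => //.
rewrite ratr_nat; apply: le_trans key _.
(* Half of the saved exponent $c_0/2$ is spent on the constant 512, which leaves $c_0/4$. *)
apply: (@le_trans _ _ (M%:R `^ (c0 / 4%:R) * M%:R `^ (1 - c0 / 2%:R))).
  rewrite ler_wpM2r ?powR_ge0 //; apply: le_trans D512 _.
  by apply: powR_le; rewrite ?divr_ge0 ?(ltW c00) // ler_nat ltnW.
rewrite -powRD; last by rewrite (gt_eqF M0) implybT.
apply: ler_powR => //; have : c' <= c0 / 4%:R by rewrite ge_min lexx.
lra.
Qed.
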